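(* Let $(\mathcal E,i),(\mathcal E',i')$ be props with $A_\infty$-multiplication and let $\widetilde{\mathcal E},\widetilde{\mathcal E}'$ be extensions of $C\mathcal E$ and $C\mathcal E'$ respectively. Suppose that there is a symmetric monoidal functor $\hat j:\widetilde{\mathcal E}\to\widetilde{\mathcal E}'$ such that $i'=j\circ i:A_\infty\to\mathcal E\to\mathcal E'$, for $j$ the restriction of $\hat j$ to $\mathcal E$. Then for any split (resp. h-split) monoidal functor $\Phi:\mathcal E'\to\mathrm{Ch}$, the canonical $\widetilde{\mathcal E}$-action (resp. homotopy $\widetilde{\mathcal E}$-action) on the pair $\big(j^*\Phi,C(j^*\Phi)\big)\cong\big(\Phi,C(\Phi)\big)$, that is on $\big(C(j^*\Phi)(0),j^*\Phi(1)\big)\cong\big(C(\Phi)(0),\Phi(1)\big)$, factors through the canonical $\widetilde{\mathcal E}'$-action (resp. homotopy $\widetilde{\mathcal E}'$-action). The same holds in the reduced case, for props with unital $A_\infty$-multiplication, replacing $C$ by $\overline C$.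
   Context: Conventions. $\mathrm{Ch}$ is the category of chain complexes over $\mathbb Z$ (usual Koszul signs). A dg-category is a category enriched in $\mathrm{Ch}$, with composition written $\mathcal E(m,n)\otimes\mathcal E(n,p)\to\mathcal E(m,p)$. A dg-functor $\Phi:\mathcal E\to\mathrm{Ch}$ (simply ''functor'') has structure chain maps $c_\Phi:\Phi(m)\otimes\mathcal E(m,n)\to\Phi(n)$. A prop is a symmetric monoidal dg-category with objects $0,1,2,\dots$ and monoidal product $+$ on objects. A functor $\Phi$ is monoidal if equipped with natural maps $\Phi(n)\otimes\Phi(m)\to\Phi(n+m)$, symmetric monoidal if these are compatible with symmetries, and split (resp. h-split) if these maps are isomorphisms (resp. quasi-isomorphisms). The props $A_\infty$, $A_\infty^+$. $A_\infty(m,n)$ is the chain complex generated by isomorphism classes of oriented planar forests consisting of $n$ trees, each with one root (outgoing leaf) and at least one incoming leaf, all vertices of valence $\ge 3$ (the tree with no vertex is allowed), with incoming leaves labeled $1,\dots,m$ and roots labeled $1,\dots,n$. An orientation of a graph with vertex set $V$ and half-edge set $H$ is a unit vector in $\det(\mathbb R(V\sqcup H))$, and $-1$ is identified with reversing orientation. The degree is $\sum_v(|v|-3)$. The differential of $G$ is the sum of all blow-ups, i.e. $\sum\tilde G$ over pairs $(\tilde G,e)$, $e$ an internal edge with $\tilde G/e=G$; if $e=\{h_1,h_2\}$ joins $v_1,v_2$, the orientation $v_1\wedge v_2\wedge h_1\wedge h_2\wedge x$ of $\tilde G$ collapses to $v\wedge x$, $v$ the new vertex. Composition grafts roots to leaves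 with the same label, wedging orientations; the monoidal structure is disjoint union. $A_\infty^+\supset A_\infty$ has in addition a degree 0 morphism $u:0\to1$ (unit): grafting $u$ onto a leaf at a trivalent vertex $v$ with half-edges $h_1,h_2,h_3$ in cyclic order deletes $v$ and that leaf (orientation $v\wedge h_1\wedge h_2\wedge h_3\wedge x\mapsto x$), and grafting it at a vertex of higher valence gives 0. A prop with (unital) $A_\infty$-multiplication is a pair $(\mathcal E,i)$ with $\mathcal E$ a prop and $i:A_\infty\to\mathcal E$ (resp. $i:A_\infty^+\to\mathcal E$) a symmetric monoidal dg-functor which is the identity on objects. Hochschild complex. Let $l_n$ ($n\ge1$) be the graph with one white vertex $w$ and $n$ leaves $h_1,\dots,h_n$ in this cyclic order, $h_1$ being the distinguished start leaf, with orientation $w\wedge h_1\wedge\dots\wedge h_n$ and degree $n-1$; $L_n=\mathbb Z l_n$. Its differential is the sum of its blow-ups: for $2\le r\le n$, $1\le j\le n$, the leaves $h_j,\dots,h_{j+r-1}$ (indices mod $n$) are moved to a new black vertex joined to $w$ by a new edge (which becomes the start half-edge at $w$ if $h_1$ is among the moved leaves), oriented so that collapsing the new edge (by the rule above) returns the orientation of $l_n$. Cutting around $w$, each blow-up is a forest in $A_\infty(n,k)$, $k=n+1-r$, grafted on $l_k$ (orientation of the forest wedge that of $l_k$), so the differential is written $d_L(l_n)=\sum_{k<n}f_{n,k}\otimes l_k$ with $f_{n,k}\in A_\infty(n,k)$. For a functor $\Phi:\mathcal E\to\mathrm{Ch}$, its Hochschild complex is the functor $C(\Phi):\mathcal E\to\mathrm{Ch}$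 with $$C(\Phi)(m)=\bigoplus_{n\ge1}\Phi(n+m)\otimes L_n,\quad d(x\otimes l_n)=d_\Phi x\otimes l_n+(-1)^{|x|}\sum_{k<n}\Phi(i(f_{n,k})+id_m)(x)\otimes l_k,$$ and a morphism $f$ of $\mathcal E$ acting by $\Phi(id_n+f)$ on the first factor (with Koszul sign $(-1)^{(n-1)|f|}$). In the unital case the reduced Hochschild complex is the quotient functor $\overline C(\Phi)(m)=\bigoplus_{n\ge1}\Phi(n+m)/U_n\otimes L_n$ with $U_n=\sum_{j=2}^n\mathrm{Im}\,\Phi(i(u_j)+id_m)$, $u_j\in A^+_\infty(n-1,n)$ inserting a unit in position $j$. $C^n(\Phi)$ denotes the $n$-fold iterate and $C^0$ the identity; thus $C^n(\Phi)(m)=\bigoplus\Phi(k_1+\dots+k_n+m)\otimes L_{k_1}\otimes\dots\otimes L_{k_n}$, and similarly for $\overline C$. The map $\lambda:C(\Phi)(0)^{\otimes n}\otimes\Phi(1)^{\otimes m}\to C^n(\Phi)(m)$, for $\Phi$ monoidal, permutes the factors (with Koszul signs) and then applies the monoidal structure maps of $\Phi$; similarly in the reduced case. It is an isomorphism if $\Phi$ is split and a quasi-isomorphism if $\Phi$ is h-split. Hochschild core category and extensions. $C\mathcal E$ has objects pairs of natural numbers $[m;n]$ and morphisms $C\mathcal E([m_1;0],[m_2;n_2])=C^{n_2}(\mathcal E(m_1,-))(m_2)$, and (apart from identities) $C\mathcal E([m_1;n_1],[m_2;n_2])=0$ for $n_1\ne0$; in particular $C\mathcal E([m_1;0],[m_2;0])=\mathcal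 E(m_1,m_2)$, so $\mathcal E$ is a full subcategory. Composition is induced by composition in $\mathcal E$. The monoidal structure is addition of pairs, with the maps $C^{n}(\mathcal E(m_1,-))(m_2)\otimes C^{n'}(\mathcal E(m_1',-))(m_2')\to C^{n+n'}(\mathcal E(m_1+m_1',-))(m_2+m_2')$ given by permuting factors and the monoidal structure of $\mathcal E$. An extension of $C\mathcal E$ is a monoidal dg-category $\widetilde{\mathcal E}$ with objects the pairs $[m;n]$ and a monoidal inclusion $C\mathcal E\hookrightarrow\widetilde{\mathcal E}$ such that $\widetilde{\mathcal E}([m_1;0],[m_2;n_2])=C\mathcal E([m_1;0],[m_2;n_2])$. $\overline C\mathcal E$ and its extensions are defined in the same way with $\overline C$ in place of $C$. The canonical action. Let $\Phi:\mathcal E\to\mathrm{Ch}$ be monoidal. For $x\otimes l_{k_1}\otimes\dots\otimes l_{k_{n_1}}\in C^{n_1}(\Phi)(m_1)$, $x\in\Phi(k+m_1)$, $k=k_1+\dots+k_{n_1}$, and $f\in\widetilde{\mathcal E}([m_1;n_1],[m_2;n_2])$, the composition in $\widetilde{\mathcal E}$ of $id_{k+m_1}\otimes l_{k_1}\otimes\dots\otimes l_{k_{n_1}}\in C\mathcal E([k+m_1;0],[m_1;n_1])$ followed by $f$ is an element $\sum g\otimes l_{k'_1}\otimes\dots\otimes l_{k'_{n_2}}$ of $C^{n_2}(\mathcal E(k+m_1,-))(m_2)$; set $(x\otimes l_{k_1}\otimes\dots\otimes l_{k_{n_1}})\cdot f=\sum\Phi(g)(x)\otimes l_{k'_1}\otimes\dots\otimes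 l_{k'_{n_2}}\in C^{n_2}(\Phi)(m_2)$. Precomposing with $\lambda$ gives $\gamma:C(\Phi)(0)^{\otimes n_1}\otimes\Phi(1)^{\otimes m_1}\otimes\widetilde{\mathcal E}([m_1;n_1],[m_2;n_2])\to C^{n_2}(\Phi)(m_2)$. The canonical action (homotopy action in the h-split case, for a choice of homotopy inverse $\lambda^{-1}$) on $(C(\Phi)(0),\Phi(1))$ is $\lambda^{-1}\circ\gamma$. The reduced case is identical with $\overline C$. Here $j^*\Phi=\Phi\circ j$.
   Formalization: The functor ĵ is taken strict, the identity on objects, and is also required to fix the generators l_k in CE([k;0],[0;1]); without this the claim fails, e.g. for ĵ(f) = (−1)^{n₂−n₁} f on Ẽ = Ẽ′. *)

(* Defs.v *)
From HB Require Import structures.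
From mathcomp Require Import all_boot all_order all_algebra.
From mathcomp Require Import boolp classical_sets functions cardinality fsbigop.

Set Implicit Arguments.
Unset Strict Implicit.
Unset Printing Implicit Defensive.

Import GRing.Theory.
Local Open Scope ring_scope.
Local Open Scope quotient_scope.

Section DirectSum.
Variables (I : choiceType) (V : I -> zmodType).

Record dsum := DSum {
  dval :> forall i, V i;
  dsum_finite : finite_set [set i | dval i != 0]%classic }.

HB.instance Definition _ := gen_eqMixin dsum.
HB.instance Definition _ := gen_choiceMixin dsum.

Lemma dsum_ext (x y : dsum) : (forall i, x i = y i) -> x = y.
Proof.
case: x y => [x xf] [y yf] /= xy.
have exy : x = y by apply: functional_extensionality_dep.
by subst y; congr DSum; apply: Prop_irrelevance.
Qed.

Lemma dsum0_finite : finite_set [set i | (0 : V i) != 0]%classic.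
Proof.
by apply: (sub_finite_set _ (@finite_set0 I)) => i /=; rewrite eqxx.
Qed.

Lemma dsumN_finite (x : dsum) : finite_set [set i | - x i != 0]%classic.
Proof.
by apply: sub_finite_set (dsum_finite x) => i /=; rewrite oppr_eq0.
Qed.

Lemma dsumD_finite (x y : dsum) :
  finite_set [set i | x i + y i != 0]%classic.
Proof.
have : finite_set ([set i | x i != 0] `|` [set i | y i != 0])%classic.
  by rewrite finite_setU; split; apply: dsum_finite.
apply: sub_finite_set => i /= xy.
have [xi0|xi] := eqVneq (x i) 0; last by left.
by right; move: xy; rewrite xi0 add0r.
Qed.

Definition dsum0 : dsum := DSum dsum0_finite.
Definition dsumN (x : dsum) : dsum := DSum (dsumN_finite x).
Definition dsumD (x y : dsum) : dsum := DSum (dsumD_finite x y).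

Lemma dsumDA : associative dsumD.
Proof. by move=> x y z; apply: dsum_ext => i /=; apply: addrA. Qed.
Lemma dsumDC : commutative dsumD.
Proof. by move=> x y; apply: dsum_ext => i /=; apply: addrC. Qed.
Lemma dsum0D : left_id dsum0 dsumD.
Proof. by move=> x; apply: dsum_ext => i /=; apply: add0r. Qed.
Lemma dsumND : left_inverse dsum0 dsumN dsumD.
Proof. by move=> x; apply: dsum_ext => i /=; apply: addNr. Qed.

HB.instance Definition _ :=
  GRing.isZmodule.Build dsum dsumDA dsumDC dsum0D dsumND.

Definition single_fun (i : I) (x : V i) (j : I) : V j :=
  match pselect (i = j) with
  | left e => ecast k (V k) e x
  | right _ => 0
  end.

Lemma single_finite (i : I) (x : V i) :
  finite_set [set j | single_fun x j != 0]%classic.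
Proof.
apply: sub_finite_set (finite_set1 i) => j /=; rewrite /single_fun.
by case: pselect => [e _|_]; [apply: esym | rewrite eqxx].
Qed.

Definition single (i : I) (x : V i) : dsum := DSum (single_finite x).

Definition dlift (W : zmodType) (G : forall i, V i -> W) (z : dsum) : W :=
  \sum_(i \in [set: I]%classic) G i (z i).

End DirectSum.

Arguments single {I V} i x.
Arguments dlift {I V W} G z.

Definition freeab (I : choiceType) : zmodType := dsum (fun _ : I => int).

Section QuotientGroup.
Variables (V : zmodType) (S : set V).

Definition in_generated : {pred V} := fun x => `[<
  forall P : set V, P 0 -> (forall y z, P y -> P z -> P (y - z)) ->
    (S `<=` P)%classic -> P x >].

Lemma in_generated_zmod : zmod_closed in_generated.
Proof.
split=> [|x y /asboolP Px /asboolP Py]; apply/asboolP => P P0 PB SP //.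
by apply: (PB); [exact: Px | exact: Py].
Qed.

HB.instance Definition _ :=
  GRing.isZmodClosed.Build V in_generated in_generated_zmod.

Definition quot_by : zmodType := Quotient.quot in_generated.
Definition qclass (x : V) : quot_by := \pi_(Quotient.quot in_generated) x.

(* Evaluates on a chosen representative: the induced map whenever [f]
   vanishes on the subgroup generated by [S] and is additive. *)
Definition descend (W : Type) (f : V -> W) (q : quot_by) : W :=
  f (repr (q : Quotient.quot in_generated)).

End QuotientGroup.

Arguments qclass {V} S x.
Arguments descend {V S W} f q.

(* A complex is encoded by its total group, the projections [part p] onto the
   degree p summands and the total differential.  The raw data are separated
   from the laws [is_complex] so that constructions apply to raw data. *)
Record complex := Complex {
  car :> zmodType;
  part : int -> car -> car;
  diff : car -> car }.

Arguments part {c} p x.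
Arguments diff {c} x.

Definition hdeg (A : complex) (p : int) (x : A) : Prop := part p x = x.

Definition additive_map (A B : zmodType) (f : A -> B) : Prop :=
  forall x y, f (x + y) = f x + f y.

Record is_complex (A : complex) : Prop := {
  part_additive : forall p, additive_map (@part A p);
  part_part : forall p q (x : A),
    part p (part q x) = if p == q then part q x else 0;
  part_finite : forall x : A, finite_set [set p | part p x != 0]%classic;
  part_sum : forall x : A, \sum_(p \in [set: int]%classic) part p x = x;
  diff_additive : additive_map (@diff A);
  diff_degree : forall p (x : A), hdeg p x -> hdeg (p - 1) (diff x);
  diff_diff : forall x : A, diff (diff x) = 0 }.

(* The operator x |-> (-1)^(k|x|) x. *)
Definition koszul (A : complex) (k : nat) (x : A) : A :=
  \sum_(p \in [set: int]%classic) part p x *~ (-1) ^+ (k * `|p|)%N.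

Definition ksign (p q : int) : int := (-1) ^+ (`|p| * `|q|)%N.

Record chain_map (A B : complex) (f : A -> B) : Prop := {
  cm_additive : additive_map f;
  cm_degree : forall p (x : A), hdeg p x -> hdeg p (f x);
  cm_diff : forall x : A, f (diff x) = diff (f x) }.

(* A chain map from the tensor product of A and B to C, as a biadditive map. *)
Record chain_pairing (A B C : complex) (f : A -> B -> C) : Prop := {
  cp_additivel : forall y, additive_map (f^~ y);
  cp_additiver : forall x, additive_map (f x);
  cp_degree : forall p q (x : A) (y : B),
    hdeg p x -> hdeg q y -> hdeg (p + q) (f x y);
  cp_diff : forall (x : A) (y : B),
    diff (f x y) = f (diff x) y + f (koszul 1 x) (diff y) }.

Definition homotopic (A B : complex) (f g : A -> B) : Prop :=
  exists h : A -> B,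
    [/\ additive_map h,
        forall p (x : A), hdeg p x -> hdeg (p + 1) (h x)
      & forall x : A, f x - g x = diff (h x) + h (diff x)].

Definition homotopy_inverse (A B : complex) (f : A -> B) (g : B -> A) : Prop :=
  [/\ chain_map g, homotopic (g \o f) idfun & homotopic (f \o g) idfun].

Definition quasi_iso (A B : complex) (f : A -> B) : Prop :=
  (forall x : A, diff x = 0 ->
     (exists y : B, f x = diff y) -> exists z : A, x = diff z) /\
  (forall y : B, diff y = 0 ->
     exists x : A, diff x = 0 /\ exists z : B, y = f x + diff z).

Definition int_complex : complex :=
  @Complex int (fun p x => if p == 0 then x else 0) (fun=> 0).

Section TensorGroup.
Variables A B : zmodType.

Definition tensor_relations : set (freeab (A * B)%type) :=
  [set z | (exists a a' b,
              z = single (a + a', b) 1 - single (a, b) 1 - single (a', b) 1)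
        \/ (exists a b b',
              z = single (a, b + b') 1 - single (a, b) 1 - single (a, b') 1)
  ]%classic.

Definition tensor_group : zmodType := quot_by tensor_relations.

Definition tpure (a : A) (b : B) : tensor_group :=
  qclass tensor_relations (single (a, b) 1).

Definition tlift (W : zmodType) (f : A -> B -> W) : tensor_group -> W :=
  descend (dlift (fun ab (c : int) => f ab.1 ab.2 *~ c)).

End TensorGroup.

Definition tensor (A B : complex) : complex :=
  @Complex (tensor_group A B)
    (fun p => tlift (fun a b =>
       \sum_(q \in [set: int]%classic) tpure (part q a) (part (p - q) b)))
    (tlift (fun a b => tpure (diff a) b + tpure (koszul 1 a) (diff b))).

Definition tensor_map (A B A' B' : complex) (f : A -> A') (g : B -> B') :
    tensor A B -> tensor A' B' :=
  tlift (fun a b => tpure (f a) (g b)).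

Fixpoint tensor_pow (A : complex) (n : nat) (B : complex) : complex :=
  if n is n'.+1 then tensor A (tensor_pow A n' B) else B.

Fixpoint tensor_pow_map (A A' B B' : complex) (f : A -> A') (g : B -> B')
    (n : nat) : tensor_pow A n B -> tensor_pow A' n B' :=
  match n with
  | 0%N => g
  | n'.+1 => tensor_map f (@tensor_pow_map A A' B B' f g n')
  end.

(* Ob is nat for props and nat * nat for extensions.  Associativity and unit
   laws on objects are propositional, hence the casts in the laws below. *)
Record mon_data (Ob : nmodType) := MonData {
  hom :> Ob -> Ob -> complex;
  idm : forall a, hom a a;
  comp : forall a b c, hom a b -> hom b c -> hom a c;
  tens : forall a b a' b', hom a b -> hom a' b' -> hom (a + a') (b + b') }.

Arguments idm {Ob} _ a.
Arguments comp {Ob} _ {a b c} f g.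
Arguments tens {Ob} _ {a b a' b'} f g.

Definition hcast (Ob : nmodType) (D : mon_data Ob) (a a' b b' : Ob)
    (ea : a = a') (eb : b = b') (f : D a b) : D a' b' :=
  ecast x (D x b') ea (ecast y (D a y) eb f).

Record is_mon_category (Ob : nmodType) (D : mon_data Ob) : Prop := {
  mon_complex : forall a b, is_complex (D a b);
  mon_comp : forall a b c, chain_pairing (@comp _ D a b c);
  mon_tens : forall a b a' b', chain_pairing (@tens _ D a b a' b');
  mon_id_degree : forall a, hdeg 0 (idm D a);
  mon_id_diff : forall a, diff (idm D a) = 0;
  mon_compA : forall a b c e (f : D a b) (g : D b c) (h : D c e),
    comp D (comp D f g) h = comp D f (comp D g h);
  mon_comp1l : forall a b (f : D a b), comp D (idm D a) f = f;
  mon_comp1r : forall a b (f : D a b), comp D f (idm D b) = f;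
  mon_tens1 : forall a b, tens D (idm D a) (idm D b) = idm D (a + b);
  mon_interchange : forall a b c a' b' c' p q
      (f : D a b) (g : D a' b') (f' : D b c) (g' : D b' c'),
    hdeg p g -> hdeg q f' ->
    comp D (tens D f g) (tens D f' g') =
      tens D (comp D f f') (comp D g g') *~ ksign p q;
  mon_tensA : forall a b a' b' a'' b''
      (f : D a b) (g : D a' b') (h : D a'' b'') ea eb,
    hcast ea eb (tens D f (tens D g h)) = tens D (tens D f g) h;
  mon_tens0l : forall a b (f : D a b) ea eb,
    hcast ea eb (tens D (idm D 0) f) = f;
  mon_tens0r : forall a b (f : D a b) ea eb,
    hcast ea eb (tens D f (idm D 0)) = f }.

Record is_symmetry (Ob : nmodType) (D : mon_data Ob)
    (s : forall a b, D (a + b) (b + a)) : Prop := {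
  sym_degree : forall a b, hdeg 0 (s a b);
  sym_diff : forall a b, diff (s a b) = 0;
  sym_natural : forall a b a' b' p q (f : D a b) (g : D a' b'),
    hdeg p f -> hdeg q g ->
    comp D (tens D f g) (s b b') =
      comp D (s a a') (tens D g f) *~ ksign p q;
  sym_inv : forall a b, comp D (s a b) (s b a) = idm D (a + b);
  sym_hexagon : forall a b c ea eb ec,
    comp D
      (hcast ea eb (tens D (s a b) (idm D c)) : D (a + (b + c)) (b + (a + c)))
      (hcast erefl ec (tens D (idm D b) (s a c)))
    = s a (b + c) }.

(* Strict, and the identity on objects. *)
Record is_mon_functor (Ob : nmodType) (D D' : mon_data Ob)
    (F : forall a b, D a b -> D' a b) : Prop := {
  mf_chain : forall a b, chain_map (F a b);
  mf_id : forall a, F a a (idm D a) = idm D' a;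
  mf_comp : forall a b c (f : D a b) (g : D b c),
    F a c (comp D f g) = comp D' (F a b f) (F b c g);
  mf_tens : forall a b a' b' (f : D a b) (g : D a' b'),
    F (a + a') (b + b') (tens D f g) = tens D' (F a b f) (F a' b' g) }.

Definition preserves_symmetry (Ob : nmodType) (D D' : mon_data Ob)
    (s : forall a b, D (a + b) (b + a)) (s' : forall a b, D' (a + b) (b + a))
    (F : forall a b, D a b -> D' a b) : Prop :=
  forall a b, F (a + b) (b + a) (s a b) = s' a b.

Record dg_prop := DgProp {
  prop_data :> mon_data nat;
  prop_sym : forall m n : nat, prop_data (m + n) (n + m);
  prop_mon : is_mon_category prop_data;
  prop_symP : is_symmetry prop_sym }.

Arguments prop_sym : clear implicits.

(* Planar trees.  [PNode ts] is a vertex with one outgoing half-edge and one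
   incoming half-edge for each element of [ts]; its cyclic order is outgoing,
   then incoming from left to right.  [PLeaf l] is the incoming leaf with
   label l (labels start at 0) and [PUnit] the unit u.  A forest is the list
   of its trees, ordered by root label. *)
Inductive ptree : Type :=
  | PUnit
  | PLeaf of nat
  | PNode of seq ptree.

HB.instance Definition _ := gen_eqMixin ptree.
HB.instance Definition _ := gen_choiceMixin ptree.

Fixpoint leaf_labels (t : ptree) : seq nat :=
  match t with
  | PUnit => [::]
  | PLeaf l => [:: l]
  | PNode ts => flatten (map leaf_labels ts)
  end.

Fixpoint stable (t : ptree) : bool :=
  match t with
  | PUnit => false
  | PLeaf _ => true
  | PNode ts => (2 <= size ts)%N && all stable ts
  end.

Definition is_unit_tree (t : ptree) : bool :=
  if t is PUnit then true else false.

(* In the unital case every composite involving u reduces to 0 or to a forest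
   whose trees are stable or equal to u. *)
Definition forest_ok (unital : bool) (m n : nat) (F : seq ptree) : bool :=
  [&& size F == n, perm_eq (flatten (map leaf_labels F)) (iota 0 m)
    & all (fun t => stable t || unital && is_unit_tree t) F].

Fixpoint tree_degree (t : ptree) : nat :=
  match t with
  | PNode ts => (size ts - 2 + sumn (map tree_degree ts))%N
  | _ => 0%N
  end.

Definition forest_degree (F : seq ptree) : nat := sumn (map tree_degree F).

Fixpoint relabel (f : nat -> nat) (t : ptree) : ptree :=
  match t with
  | PUnit => PUnit
  | PLeaf l => PLeaf (f l)
  | PNode ts => PNode (map (relabel f) ts)
  end.

(* Trees with named vertices and half-edges: [DNode v o hs ts] has vertex v,
   outgoing half-edge o and incoming half-edges hs.  The half-edge of a leaf is
   the one at the vertex carrying it; the tree without vertices has none. *)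
Inductive dtree : Type :=
  | DUnit
  | DLeaf of nat
  | DNode of nat & nat & seq nat & seq dtree.

Fixpoint word (t : dtree) : seq nat :=
  match t with
  | DNode v o hs ts => v :: o :: hs ++ flatten (map word ts)
  | _ => [::]
  end.

(* An orientation is a list of all names of vertices and half-edges, standing
   for the wedge of its entries; [forest_word] is the reference orientation.
   Planar forests with labelled leaves and roots have no automorphisms, so the
   free group on undecorated forests, each with its reference orientation, is
   the group of oriented forests modulo orientation reversal. *)
Definition forest_word (F : seq dtree) : seq nat := flatten (map word F).

Fixpoint inversions (s : seq nat) : nat :=
  if s is x :: s' then (count (fun y => (y < x)%N) s' + inversions s')%N
  else 0%N.

(* The sign e with w = e w', for w and w' orderings of the same names. *)
Definition osign (w w' : seq nat) : int :=
  (-1) ^+ inversions [seq index x w' | x <- w].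

Fixpoint word_size (t : ptree) : nat :=
  match t with
  | PNode ts => (2 + size ts + sumn (map word_size ts))%N
  | _ => 0%N
  end.

(* Names s, s+1, ... are given in the order of the reference orientation. *)
Fixpoint decorate (s : nat) (t : ptree) : dtree :=
  match t with
  | PUnit => DUnit
  | PLeaf l => DLeaf l
  | PNode ts =>
      DNode s s.+1 (iota s.+2 (size ts))
        ((fix go r us := match us with
          | [::] => [::]
          | u :: us' => decorate r u :: go (r + word_size u)%N us'
          end) (s.+2 + size ts)%N ts)
  end.

Fixpoint decorate_forest (s : nat) (F : seq ptree) : seq dtree :=
  match F with
  | [::] => [::]
  | t :: F' => decorate s t :: decorate_forest (s + word_size t)%N F'
  end.

Fixpoint erase (t : dtree) : ptree :=
  match t with
  | DUnit => PUnit
  | DLeaf l => PLeaf l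
  | DNode _ _ _ ts => PNode (map erase ts)
  end.

Fixpoint graft (F : seq dtree) (t : dtree) : dtree :=
  match t with
  | DUnit => DUnit
  | DLeaf l => nth DUnit F l
  | DNode v o hs ts => DNode v o hs (map (graft F) ts)
  end.

Definition is_dunit (t : dtree) : bool := if t is DUnit then true else false.

(* Removal of the units grafted at a vertex; [None] stands for 0.  The list
   returned with the tree consists of the names v, h1, h2, h3 deleted from the
   front of the orientation. *)
Definition absorb (v o : nat) (hs : seq nat) (ts : seq dtree) :
    option (seq nat * dtree) :=
  match hs, ts with
  | [:: h1; h2], [:: DUnit; t] => Some ([:: v; o; h1; h2], t)
  | [:: h1; h2], [:: t; DUnit] => Some ([:: v; o; h1; h2], t)
  | _, _ => if has is_dunit ts then None else Some ([::], DNode v o hs ts)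
  end.

Fixpoint collect (s : seq (option (seq nat * dtree))) :
    option (seq nat * seq dtree) :=
  match s with
  | [::] => Some ([::], [::])
  | x :: s' =>
      match x, collect s' with
      | Some (q, t), Some (r, ts) => Some (q ++ r, t :: ts)
      | _, _ => None
      end
  end.

Fixpoint absorb_units (t : dtree) : option (seq nat * dtree) :=
  match t with
  | DNode v o hs ts =>
      match collect (map absorb_units ts) with
      | Some (q, ts') =>
          match absorb v o hs ts' with
          | Some (r, t') => Some (q ++ r, t')
          | None => None
          end
      | None => None
      end
  | _ => Some ([::], t)
  end.

Definition compose_forests (F G : seq ptree) : option (int * seq ptree) :=
  let DF := decorate_forest 0 F in
  let DG := decorate_forest (sumn (map word_size F)) G in
  match collect (map absorb_units (map (graft DF) DG)) with
  | Some (q, D) =>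
      Some (osign (forest_word DF ++ forest_word DG) (q ++ forest_word D),
            map erase D)
  | None => None
  end.

(* All (v, t') such that t is obtained from t' by collapsing an internal edge
   to the vertex v.  In t' the lower end of that edge is v with half-edge b+1
   and the upper end is b with half-edge b+2, where b, b+1, b+2 are fresh. *)
Fixpoint blowups (b : nat) (t : dtree) : seq (nat * dtree) :=
  match t with
  | DNode v o hs ts =>
      [seq (v, DNode v o
                 (take j hs ++ b.+1 :: drop (j + r) hs)
                 (take j ts
                  ++ DNode b b.+2 (take r (drop j hs)) (take r (drop j ts))
                  :: drop (j + r) ts))
      | r <- iota 2 (size ts - 2), j <- iota 0 (size ts - r).+1]
      ++ (fix go pre us := match us with
          | [::] => [::]
          | u :: us' =>
              [seq (p.1, DNode v o hs (pre ++ p.2 :: us')) | p <- blowups b u]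
              ++ go (rcons pre u) us'
          end) [::] ts
  | _ => [::]
  end.

Fixpoint forest_blowups (b : nat) (pre F : seq dtree) :
    seq (nat * seq dtree) :=
  match F with
  | [::] => [::]
  | t :: F' => [seq (p.1, pre ++ p.2 :: F') | p <- blowups b t]
               ++ forest_blowups b (rcons pre t) F'
  end.

(* First sign: the reference orientation of F as a wedge v /\ x.  Second sign:
   v1 /\ v2 /\ h1 /\ h2 /\ x against the reference orientation. *)
Definition blowup_terms (F : seq ptree) : seq (int * seq ptree) :=
  let D := decorate_forest 0 F in
  let w := forest_word D in
  let b := size w in
  [seq let: (v, D') := p in
       (osign w (v :: rem v w) *
        osign [:: v, b, b.+1, b.+2 & rem v w] (forest_word D'),
        map erase D')
  | p <- forest_blowups b [::] D].

Section Ainfinity.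
Variable unital : bool.

Definition forest (m n : nat) : Type :=
  {F : seq ptree | forest_ok unital m n F}.

Definition fterm (m n : nat) (c : int) (F : seq ptree) : freeab (forest m n) :=
  if insub F is Some F' then single (F' : forest m n) c else 0.

Definition ainf_hom (m n : nat) : complex :=
  @Complex (freeab (forest m n))
    (fun p => dlift (fun (F : forest m n) (c : int) =>
       if (forest_degree (val F))%:Z == p then single F c else 0))
    (dlift (fun (F : forest m n) (c : int) =>
       \sum_(t <- blowup_terms (val F)) fterm m n (c * t.1) t.2)).

Definition ainf_id (m : nat) : ainf_hom m m :=
  fterm m m 1 (map PLeaf (iota 0 m)).

Definition ainf_comp (m n p : nat) (x : ainf_hom m n) (y : ainf_hom n p) :
    ainf_hom m p :=
  dlift (fun (F : forest m n) (c : int) =>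
    dlift (fun (G : forest n p) (e : int) =>
      if compose_forests (val F) (val G) is Some (s, H)
      then fterm m p (s * c * e) H else 0) y) x.

(* The concatenated words form the reference orientation, hence no sign. *)
Definition ainf_tens (m n m' n' : nat)
    (x : ainf_hom m n) (y : ainf_hom m' n') :
    ainf_hom (m + m')%R (n + n')%R :=
  dlift (fun (F : forest m n) (c : int) =>
    dlift (fun (G : forest m' n') (e : int) =>
      fterm (m + m')%R (n + n')%R (c * e)
        (val F ++ map (relabel (addn m)) (val G))) y) x.

Definition ainf : mon_data nat :=
  @MonData _ ainf_hom ainf_id ainf_comp ainf_tens.

Definition ainf_sym (m n : nat) : ainf (m + n) (n + m) :=
  fterm _ _ 1 (map PLeaf (iota m n ++ iota 0 m)).

(* u_j inserts a unit in position j, with j starting at 0. *)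
Definition unit_forest (n j : nat) : ainf n n.+1 :=
  fterm _ _ 1 (map PLeaf (iota 0 j) ++ PUnit :: map PLeaf (iota j (n - j))).

(* The blow-up of l_n moving the r leaves h_j, h_{j+1}, ..., all indices modulo
   n and starting at 0, with the forest cut out around the white vertex w.  The
   name of h_i is i; the new edge has half-edge ew at w and eb at the black
   vertex b; gs lists the half-edges at w from its start half-edge. *)
Definition hochschild_term (n r j : nat) : int * seq ptree :=
  let w := n in let b := n.+1 in let ew := n.+2 in let eb := n.+3 in
  let moved := [seq ((j + i) %% n)%N | i <- iota 0 r] in
  let rest := [seq ((j + r + i) %% n)%N | i <- iota 0 (n - r)] in
  let cyc := ew :: rest in
  let gs := if 0%N \in moved then cyc else rot (index 0%N cyc) cyc in
  (osign [:: w, b, ew, eb & iota 0 n] ([:: b, eb & moved] ++ w :: gs),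
   [seq if g == ew then PNode (map PLeaf moved) else PLeaf g | g <- gs]).

(* The coefficient f_{n,k} of l_k in the differential of l_n, for 0 < k < n. *)
Definition hochschild_coef (n k : nat) : ainf n k :=
  \sum_(t <- [seq hochschild_term n (n.+1 - k) j | j <- iota 0 n])
    fterm n k t.1 t.2.

End Ainfinity.

Record mult_prop (unital : bool) := MultProp {
  mprop :> dg_prop;
  mult : forall m n, ainf unital m n -> mprop m n;
  mult_functor : is_mon_functor mult;
  mult_sym :
    preserves_symmetry (@ainf_sym unital) (prop_sym mprop) mult }.

Record fun_data (D : mon_data nat) := FunData {
  val_at :> nat -> complex;
  act : forall m n, val_at m -> D m n -> val_at n }.

Arguments act {D} _ {m n} x f.

Record is_dg_functor (D : mon_data nat) (Phi : fun_data D) : Prop := {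
  fun_complex : forall n, is_complex (Phi n);
  fun_pairing : forall m n, chain_pairing (@act D Phi m n);
  fun_id : forall m (x : Phi m), act Phi x (idm D m) = x;
  fun_comp : forall m n p (x : Phi m) (f : D m n) (g : D n p),
    act Phi (act Phi x f) g = act Phi x (comp D f g) }.

Definition vcast (D : mon_data nat) (Phi : fun_data D) (m n : nat) (e : m = n)
  (x : Phi m) : Phi n := ecast k (Phi k) e x.

Record mfun_data (D : mon_data nat) := MFunData {
  mfun :> fun_data D;
  munit : mfun 0%N;
  mmul : forall m n, mfun m -> mfun n -> mfun (m + n)%R }.

Arguments munit {D} _.
Arguments mmul {D} _ {m n} x y.

Record is_monoidal (D : mon_data nat) (Phi : mfun_data D) : Prop := {
  mfun_functor : is_dg_functor Phi;
  munit_degree : hdeg 0 (munit Phi);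
  munit_diff : diff (munit Phi) = 0;
  mmul_pairing : forall m n, chain_pairing (@mmul D Phi m n);
  mmul_natural : forall m n m' n' p q
      (x : Phi m) (y : Phi m') (f : D m n) (g : D m' n'),
    hdeg p y -> hdeg q f ->
    act Phi (mmul Phi x y) (tens D f g) =
      mmul Phi (act Phi x f) (act Phi y g) *~ ksign p q;
  mmulA : forall m n p (x : Phi m) (y : Phi n) (z : Phi p) e,
    vcast e (mmul Phi x (mmul Phi y z)) = mmul Phi (mmul Phi x y) z;
  mmul1l : forall m (x : Phi m) e, vcast e (mmul Phi (munit Phi) x) = x;
  mmul1r : forall m (x : Phi m) e, vcast e (mmul Phi x (munit Phi)) = x }.

Definition is_split (D : mon_data nat) (Phi : mfun_data D) : Prop :=
  bijective (fun c : int_complex => munit Phi *~ c) /\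
  forall m n, bijective (tlift (@mmul D Phi m n) :
                           tensor (Phi m) (Phi n) -> Phi (m + n)%R).

Definition is_hsplit (D : mon_data nat) (Phi : mfun_data D) : Prop :=
  quasi_iso (fun c : int_complex => munit Phi *~ c) /\
  forall m n, quasi_iso (tlift (@mmul D Phi m n) :
                           tensor (Phi m) (Phi n) -> Phi (m + n)%R).

Definition corep (D : mon_data nat) (m : nat) : fun_data D :=
  @FunData D (D m) (fun n p f g => comp D f g).

Section Hochschild.
Variables (unital : bool) (D : mon_data nat).
Variable i : forall m n, ainf unital m n -> D m n.

Section Construction.
Variable Phi : fun_data D.

(* The summand with index n is the one of l_{n+1}, which has degree n. *)
Definition hoch_group (m : nat) : zmodType :=
  dsum (fun n : nat => Phi (n.+1 + m)%R : zmodType).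

Definition hoch_val (m : nat) : complex :=
  @Complex (hoch_group m)
    (fun p => dlift (fun n (x : Phi (n.+1 + m)%R) =>
       single n (part (p - n%:Z) x)))
    (dlift (fun n (x : Phi (n.+1 + m)%R) =>
       (single n (diff x) : hoch_group m)
       + \sum_(k < n) single (nat_of_ord k)
           (act Phi (koszul 1 x)
              (tens D (i (hochschild_coef unital n.+1 k.+1)) (idm D m))))).

Definition hoch_act (m m' : nat) (z : hoch_val m) (f : D m m') : hoch_val m' :=
  dlift (fun n (x : Phi (n.+1 + m)%R) =>
    (single n (act Phi x (tens D (idm D n.+1) (koszul n f)))
       : hoch_group m')) z.

Definition hoch : fun_data D := @FunData D hoch_val hoch_act.

Definition degenerate (m : nat) : set (hoch_group m) :=
  [set z | exists n j (y : Phi (n + m)%R), (0 < j <= n)%N /\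
     z = single n (act Phi y (tens D (i (unit_forest unital n j)) (idm D m)))
  ]%classic.

Definition rhoch_val (m : nat) : complex :=
  @Complex (quot_by (degenerate (m:=m)))
    (fun p => descend (fun z : hoch_val m => qclass _ (part p z)))
    (descend (fun z : hoch_val m => qclass _ (diff z))).

Definition rhoch : fun_data D :=
  @FunData D rhoch_val (fun m m' z f =>
    descend (fun z : hoch_val m => qclass (degenerate (m:=m')) (hoch_act z f))
      z).

(* The Hochschild complex, in its reduced version in the unital case. *)
Definition hochschild : fun_data D := if unital then rhoch else hoch.

(* x |-> x (x) l_{n+1} *)
Definition hsingle (m n : nat) (x : Phi (n.+1 + m)%R) : hochschild m :=
  match unital as u return (if u then rhoch else hoch) m with
  | true => qclass (degenerate (m:=m)) (single n x)
  | false => single n x : hoch_group m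
  end.

(* The additive map taking x (x) l_{n+1} to G n x. *)
Definition hlift (m : nat) (W : zmodType)
    (G : forall n : nat, Phi (n.+1 + m)%R -> W) : hochschild m -> W :=
  match unital as u return (if u then rhoch else hoch) m -> W with
  | true => descend (dlift G)
  | false => dlift G
  end.

End Construction.

(* The n-fold iterate; the outermost complex carries the last factor L. *)
Definition hochn (n : nat) (Phi : fun_data D) : fun_data D :=
  iter n hochschild Phi.

(* For ks = [:: k_n; ...; k_1], the sum (k_1+1) + (... + ((k_n+1) + m)). *)
Fixpoint ksum (ks : seq nat) (m : nat) : nat :=
  if ks is k :: ks' then ksum ks' (k.+1 + m)%R else m.

(* For ks = [:: k_n; ...; k_1], the element
   x (x) l_{k_1 + 1} (x) ... (x) l_{k_n + 1}; junk 0 if size ks <> n. *)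
Fixpoint hpure (Phi : fun_data D) (n : nat) (ks : seq nat) (m : nat) :
    Phi (ksum ks m) -> hochn n Phi m :=
  match n, ks return Phi (ksum ks m) -> hochn n Phi m with
  | 0%N, [::] => id
  | n'.+1, k :: ks' => fun x =>
      hsingle (Phi := hochn n' Phi) (hpure n' (m := (k.+1 + m)%R) x)
  | _, _ => fun=> 0
  end.

(* The additive map taking hpure n ks x to G ks x. *)
Fixpoint hliftn (Phi : fun_data D) (n m : nat) (W : zmodType) :
    (forall ks, Phi (ksum ks m) -> W) -> hochn n Phi m -> W :=
  match n return (forall ks, Phi (ksum ks m) -> W) -> hochn n Phi m -> W with
  | 0%N => fun G => G [::]
  | n'.+1 => fun G =>
      hlift (Phi := hochn n' Phi) (fun k =>
        hliftn (Phi := Phi) (n := n') (m := (k.+1 + m)%R)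
          (fun ks => G (k :: ks)))
  end.

End Hochschild.

Arguments hpure {unital D} i {Phi} n ks {m} x.
Arguments hliftn {unital D} i {Phi} n {m W} G z.
Arguments hsingle {unital D} i {Phi m} n x.
Arguments hlift {unital D} i {Phi m W} G z.

Lemma ksumE ks m : ksum ks m = (sumn (map succn ks) + m)%N.
Proof.
elim: ks m => [|k ks IH] m //=.
by rewrite IH -[(k.+1 + m)%R]/(k.+1 + m)%N addnA [(sumn _ + _)%N]addnC.
Qed.

(* Functoriality in families of additive maps, possibly between functors on
   different props: x (x) l (x) ... (x) l |-> F x (x) l (x) ... (x) l. *)
Definition hochn_map (unital : bool) (D D' : mon_data nat)
    (i : forall m n, ainf unital m n -> D m n)
    (i' : forall m n, ainf unital m n -> D' m n)
    (Phi : fun_data D) (Phi' : fun_data D')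
    (F : forall m, Phi m -> Phi' m) (n m : nat) :
    hochn i n Phi m -> hochn i' n Phi' m :=
  hliftn i n (fun ks x => hpure i' n ks (F (ksum ks m) x)).

Arguments hochn_map {unital D D'} i i' {Phi Phi'} F n {m} z.

Section Core.
Variables (unital : bool) (E : mult_prop unital).

(* Morphisms from [m1;0] to [m2;n] in the Hochschild core category. *)
Definition core_hom (m1 m2 n : nat) : complex :=
  hochn (@mult _ E) n (corep E m1) m2.

Definition core_comp (m1 m2 m3 n : nat) (f : E m1 m2)
    (z : core_hom m2 m3 n) : core_hom m1 m3 n :=
  hochn_map (@mult _ E) (@mult _ E)
    (Phi := corep E m2) (Phi' := corep E m1) (fun k g => comp E f g) n z.

Lemma shuffle_dom (ks ls : seq nat) (m m' : nat) :
  ((sumn (map succn ks) + (m + sumn (map succn ls))) + m' =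
   ksum ks m + ksum ls m')%R.
Proof. by rewrite !ksumE !natrDE !addnA. Qed.

Lemma shuffle_cod (ks ls : seq nat) (m m' : nat) :
  ((sumn (map succn ks) + (sumn (map succn ls) + m)) + m' =
   ksum (ls ++ ks) (m + m'))%R.
Proof.
rewrite ksumE map_cat sumn_cat [(sumn [seq _ | _ <- ls] + _)%N]addnC.
by rewrite !natrDE !addnA.
Qed.

(* id + (symmetry) + id, moving the inputs of the second factor to the left. *)
Definition shuffle (ks ls : seq nat) (m m' : nat) :
    E (ksum ks m + ksum ls m')%R (ksum (ls ++ ks) (m + m')%R) :=
  hcast (shuffle_dom ks ls m m') (shuffle_cod ks ls m m')
    (tens E (tens E (idm E (sumn (map succn ks)))
                    (prop_sym E m (sumn (map succn ls))))
            (idm E m')).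

(* (g (x) ls) (x) (g' (x) ls') |-> +/- (g + g') (x) ls (x) ls', with the sign
   of moving the factors l of the first element past g'. *)
Definition core_tens (m1 m2 n m1' m2' n' : nat)
    (y : core_hom m1 m2 n) (z : core_hom m1' m2' n') :
    core_hom (m1 + m1')%R (m2 + m2')%R (n + n')%R :=
  hliftn (@mult _ E) (Phi := corep E m1) n (fun ks (g : E m1 (ksum ks m2)) =>
    hliftn (@mult _ E) (Phi := corep E m1') n' (fun ls (g' : E m1' (ksum ls m2')) =>
      hpure (@mult _ E) (Phi := corep E (m1 + m1')%R) (n + n')%R (ls ++ ks)
        (comp E (tens E g (koszul (sumn ks) g')) (shuffle ks ls m2 m2'))) z) y.

(* The object [m;n] is the pair (m, n). *)
Record extension := Extension {
  ext_data :> mon_data (nat * nat)%type;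
  ext_mon : is_mon_category ext_data;
  inc : forall m1 m2 n, core_hom m1 m2 n -> ext_data (m1, 0%N) (m2, n);
  ret : forall m1 m2 n, ext_data (m1, 0%N) (m2, n) -> core_hom m1 m2 n;
  incK : forall m1 m2 n, cancel (@inc m1 m2 n) (@ret m1 m2 n);
  retK : forall m1 m2 n, cancel (@ret m1 m2 n) (@inc m1 m2 n);
  inc_chain : forall m1 m2 n, chain_map (@inc m1 m2 n);
  inc_id : forall m,
    inc (idm E m : core_hom m m 0) = idm ext_data (m, 0%N);
  inc_comp : forall m1 m2 m3 n (f : core_hom m1 m2 0) (z : core_hom m2 m3 n),
    comp ext_data (inc f) (inc z) = inc (core_comp f z);
  inc_tens : forall m1 m2 n m1' m2' n'
      (y : core_hom m1 m2 n) (z : core_hom m1' m2' n'),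
    tens ext_data (inc y) (inc z) = inc (core_tens y z) }.

Record ext_symmetry (X : extension) := ExtSymmetry {
  ext_sym :> forall a b : (nat * nat)%type, X (a + b) (b + a);
  ext_symP : is_symmetry ext_sym;
  ext_sym_prop : forall m n : nat,
    @inc X (m + n)%R (n + m)%R 0 (prop_sym E m n) =
      ext_sym (m, 0%N) (n, 0%N) }.

End Core.

Arguments inc {unital E} _ {m1 m2 n} z.
Arguments ret {unital E} _ {m1 m2 n} f.

Section Action.
Variables (unital : bool) (E : mult_prop unital) (X : extension E).
Variable Phi : mfun_data E.

Notation Ch n := (hochn (@mult _ E) n Phi).

Definition source (n m : nat) : complex :=
  tensor_pow (Ch 1 0%N) n (tensor_pow (Phi 1%N) m int_complex).

Fixpoint lambda0 (m : nat) : tensor_pow (Phi 1%N) m int_complex -> Phi m :=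
  match m return tensor_pow (Phi 1%N) m int_complex -> Phi m with
  | 0%N => fun c => munit Phi *~ (c : int)
  | m'.+1 => tlift (fun (x : Phi 1%N) t => mmul Phi x (@lambda0 m' t) : Phi m'.+1)
  end.

Lemma ksum_rcons k ks m :
  ((k.+1 + 0) + ksum ks m = ksum (rcons ks k) m)%R.
Proof.
rewrite !ksumE map_rcons -cats1 sumn_cat /= !natrDE !addn0.
by rewrite [(sumn _ + k.+1)%N]addnC addnA.
Qed.

(* (x (x) l_k) (x) (y (x) ls) |-> +/- (x y) (x) l_k (x) ls, with the sign of
   moving l_k past y. *)
Definition lambda_mul (n m : nat) (z : Ch 1 0%N) (y : Ch n m) : Ch n.+1 m :=
  hlift (@mult _ E) (fun k (x : Phi (k.+1 + 0)%R) =>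
    hliftn (@mult _ E) n (fun ks (v : Phi (ksum ks m)) =>
      hpure (@mult _ E) n.+1 (rcons ks k)
        (vcast (ksum_rcons k ks m) (mmul Phi x (koszul k v)))) y) z.

Fixpoint lambda (n m : nat) : source n m -> Ch n m :=
  match n return source n m -> Ch n m with
  | 0%N => @lambda0 m
  | n'.+1 => tlift (fun z t => lambda_mul z (@lambda n' m t))
  end.

Definition ext_act (n1 m1 n2 m2 : nat) (z : Ch n1 m1)
    (f : X (m1, n1) (m2, n2)) : Ch n2 m2 :=
  hliftn (@mult _ E) n1 (fun ks (x : Phi (ksum ks m1)) =>
    hochn_map (@mult _ E) (@mult _ E) (Phi := corep E (ksum ks m1))
      (fun p (g : E (ksum ks m1) p) => act Phi x g) n2
      (ret X (comp X
        (inc X (hpure (@mult _ E) (Phi := corep E (ksum ks m1)) n1 ks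
                  (idm E (ksum ks m1)) : core_hom E (ksum ks m1) m1 n1))
        f))) z.

Definition gamma (n1 m1 n2 m2 : nat) (t : source n1 m1)
    (f : X (m1, n1) (m2, n2)) : Ch n2 m2 := ext_act (lambda t) f.

Definition action (linv : forall n m, Ch n m -> source n m) (n1 m1 n2 m2 : nat)
    (t : source n1 m1) (f : X (m1, n1) (m2, n2)) : source n2 m2 :=
  linv n2 m2 (gamma t f).

Definition lambda_inverse (linv : forall n m, Ch n m -> source n m) : Prop :=
  forall n m, cancel (@lambda n m) (linv n m) /\
              cancel (linv n m) (@lambda n m).

Definition lambda_homotopy_inverse
    (linv : forall n m, Ch n m -> source n m) : Prop :=
  forall n m, homotopy_inverse (@lambda n m) (linv n m).

End Action.

Section Change.
Variables (unital : bool) (E E' : mult_prop unital).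
Variables (X : extension E) (X' : extension E').
Variable J : forall a b : (nat * nat)%type, X a b -> X' a b.

(* J fixes the element l_{k+1} of C(E(k+1,-))(0).  Together with functoriality
   this says that J restricts to the functor of core categories induced by its
   restriction to the props. *)
Definition preserves_generators : Prop :=
  forall k : nat,
    J (inc X (hpure (@mult _ E) (Phi := corep E (k.+1 + 0)%R) 1 [:: k]
                (idm E (k.+1 + 0)%R) : core_hom E (k.+1 + 0)%R 0 1)) =
    inc X' (hpure (@mult _ E') (Phi := corep E' (k.+1 + 0)%R) 1 [:: k]
              (idm E' (k.+1 + 0)%R) : core_hom E' (k.+1 + 0)%R 0 1).

Definition restriction (m n : nat) (f : E m n) : E' m n :=
  ret X' (J (inc X (f : core_hom E m n 0))) : core_hom E' m n 0.

Definition pullback (Phi : mfun_data E') : mfun_data E :=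
  @MFunData E
    (@FunData E Phi (fun m n x f => act Phi x (restriction f)))
    (munit Phi) (fun m n x y => mmul Phi x y).

Variable Phi : mfun_data E'.

(* The identification of the iterated Hochschild complexes of the pullback of
   Phi with those of Phi, given by the identity of Phi. *)
Definition identify (n m : nat) :
    hochn (@mult _ E) n (pullback Phi) m -> hochn (@mult _ E') n Phi m :=
  hochn_map (@mult _ E) (@mult _ E') (Phi := pullback Phi) (Phi' := Phi)
    (fun k (x : Phi k) => x) n.

Definition identify_source (n m : nat) :
    source (pullback Phi) n m -> source Phi n m :=
  tensor_pow_map (@identify 1 0%N) idfun (n := n).

Definition identification : Prop :=
  (forall m, bijective (@identify 1 m) /\ chain_map (@identify 1 m)) /\
  (forall m m' (z : hochn (@mult _ E) 1 (pullback Phi) m) (f : E m m'),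
     identify (act (hochn (@mult _ E) 1 (pullback Phi)) z f) =
     act (hochn (@mult _ E') 1 Phi) (identify z) (restriction f)).

Definition factors
    (linv : forall n m, hochn (@mult _ E) n (pullback Phi) m ->
                        source (pullback Phi) n m)
    (linv' : forall n m, hochn (@mult _ E') n Phi m -> source Phi n m) : Prop :=
  forall n1 m1 n2 m2 (t : source (pullback Phi) n1 m1)
         (f : X (m1, n1) (m2, n2)),
    identify_source (action linv t f) =
    action linv' (identify_source t) (J f).

(* Every canonical action of X, for a choice of inverses of lambda satisfying
   [P], is the restriction along J of the canonical action of X' for a choice
   satisfying [P'], and every choice satisfying [P'] arises in this way. *)
Definition factors_through
    (P : (forall n m, hochn (@mult _ E) n (pullback Phi) m ->
                      source (pullback Phi) n m) -> Prop)
    (P' : (forall n m, hochn (@mult _ E') n Phi m -> source Phi n m) -> Prop) :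
    Prop :=
  (forall linv, P linv -> exists linv', P' linv' /\ factors linv linv') /\
  (forall linv', P' linv' -> exists linv, P linv /\ factors linv linv').

End Change.

(* Main.v *)
(* Hochschild complexes of the pullback are computed from the values of Phi and
   from the action of Hochschild coefficients and units, which J intertwines; so
   the iterated complexes of the pullback and of Phi are literally equal, and
   with them the sources and the maps lambda.  It remains to compare the
   two actions, which reduces to J acting on C^n(E(k,-))(m) by restriction on
   the factor E(k,-).  Every element there is a sum of composites of morphisms
   of E with the elements id (x) l_{k_1} (x) ... (x) l_{k_n}, and these are
   tensor products of the generators fixed by J and an identity. *)
Require Import Defs.
From HB Require Import structures.
From mathcomp Require Import all_boot all_order all_algebra.
From mathcomp Require Import boolp classical_sets functions cardinality fsbigop.
(* [comp] denotes the composition of [mon_data], not that of functions. *)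
Import Defs.

Set Implicit Arguments.
Unset Strict Implicit.
Unset Printing Implicit Defensive.

Import GRing.Theory.
Local Open Scope ring_scope.
Local Open Scope quotient_scope.

(** * Additive maps, direct sums and quotients *)

(** Maps out of quotients are defined by evaluation at chosen representatives, and this decides how
    each comparison is made. Where both sides are built from the same data up to [J], the functors
    are proved equal as records, so that the same representatives are chosen and inverses of
    [lambda], strict or up to homotopy, can be transported along an equality. Where the sides
    differ, as in [core_tens] and in composition in the core, the families on generators are first
    shown to kill inserted units; this follows from naturality and from units having degree 0, so
    that no sign arises. A second obstacle is that tensor products in the core contain block
    symmetries. In the cases that occur one of the blocks is the object 0, and the hexagon forces
    such a symmetry to be an identity up to a cast. *)

Lemma finite_fsum (D : zmodType) (I : choiceType) (F : I -> D) :
  finite_set [set i | F i != 0]%classic ->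
  exists2 r : seq I, uniq r & forall (D' : zmodType) (G : I -> D'),
    (forall i, F i = 0 -> G i = 0) ->
    \sum_(i \in [set: I]%classic) G i = \sum_(i <- r) G i.
Proof.
(* One list serves every [G] vanishing where [F] does, so that sums in different groups can be
   compared over the same indices. *)
move=> fin; exists (finite_support 0 [set: I] F)%classic => // D' G FG.
rewrite (fsbigE (finite_support 0 [set: I] F)%classic) //.
  by apply: eq_bigl => i; rewrite in_setT.
move=> i _ iF; apply: FG; apply: contrapT => Fi0; move/negP: iF; apply.
rewrite in_finite_support; first by apply: mem_set.
by rewrite setTI; apply: sub_finite_set fin => j /= /eqP.
Qed.

Section AdditiveMaps.
Variables (A B : zmodType) (f : A -> B).
Hypothesis f_add : additive_map f.

Lemma additive_map0 : f 0 = 0.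
Proof. by apply: (addrI (f 0)); rewrite -f_add !addr0. Qed.

Lemma additive_mapN x : f (- x) = - f x.
Proof. by apply: (addrI (f x)); rewrite -f_add !subrr additive_map0. Qed.

Lemma additive_mapB x y : f (x - y) = f x - f y.
Proof. by rewrite f_add additive_mapN. Qed.

Lemma additive_map_mulrz x (c : int) : f (x *~ c) = f x *~ c.
Proof.
have fn n : f (x *+ n) = f x *+ n.
  by elim: n => [|n IH]; rewrite ?mulr0n ?additive_map0 // !mulrS f_add IH.
by case: c => n; rewrite ?NegzE ?mulrNz -!pmulrn ?additive_mapN fn.
Qed.

Lemma additive_map_sum (I : Type) (r : seq I) (P : pred I) (F : I -> A) :
  f (\sum_(i <- r | P i) F i) = \sum_(i <- r | P i) f (F i).
Proof. exact: (big_morph f f_add additive_map0). Qed.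

Lemma additive_map_fsum (I : choiceType) (F : I -> A) :
  finite_set [set i | F i != 0]%classic ->
  f (\sum_(i \in [set: I]%classic) F i) = \sum_(i \in [set: I]%classic) f (F i).
Proof.
move=> /finite_fsum[r _ H]; rewrite (H _ F) // additive_map_sum (H _ (f \o F)) //=.
by move=> i ->; rewrite additive_map0.
Qed.

End AdditiveMaps.

Lemma fsum_add (D : zmodType) (I : choiceType) (F G : I -> D) :
  finite_set [set i | F i != 0]%classic ->
  finite_set [set i | G i != 0]%classic ->
  \sum_(i \in [set: I]%classic) (F i + G i) =
  \sum_(i \in [set: I]%classic) F i + \sum_(i \in [set: I]%classic) G i.
Proof.
move=> finF finG.
(* The indicator of the union of both supports yields a single list for [F], [G] and their sum. *)
pose b i : int := if (F i != 0) || (G i != 0) then 1 else 0.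
have b0 i : b i = 0 -> F i = 0 /\ G i = 0.
  rewrite /b; case: ifP => // /negbT; rewrite negb_or !negbK.
  by move=> /andP[/eqP-> /eqP->].
have [|r _ H] := @finite_fsum int I b.
  have : finite_set ([set i | F i != 0] `|` [set i | G i != 0])%classic.
    by rewrite finite_setU.
  apply: sub_finite_set => i /=; rewrite /b; case: ifP; rewrite ?eqxx //.
  by move=> /orP.
rewrite (H _ (fun i => F i + G i)) ?(H _ F) ?(H _ G) ?big_split //.
- by move=> i /b0[].
- by move=> i /b0[].
- by move=> i /b0[-> ->]; rewrite addr0.
Qed.

Lemma fsum_single (D : zmodType) (I : choiceType) (F : I -> D) (i : I) :
  (forall j, j != i -> F j = 0) -> \sum_(j \in [set: I]%classic) F j = F i.
Proof.
move=> Fi; rewrite (fsbigE [:: i]) //=.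
  by rewrite big_mkcond big_seq1 in_setT.
by move=> j _; rewrite inE => /Fi.
Qed.

Section DirectSumTheory.
Variables (I : choiceType) (V : I -> zmodType) (W : zmodType).
Implicit Types (G : forall i, V i -> W) (z : dsum V).

Lemma dsum_addE z z' i : (z + z') i = z i + z' i. Proof. by []. Qed.

Lemma single_eq i (x : V i) : single i x i = x.
Proof.
rewrite /= /single_fun; case: pselect => // e.
by rewrite (Prop_irrelevance e erefl).
Qed.

Lemma single_neq i j (x : V i) : j != i -> single i x j = 0.
Proof.
by move=> ji; rewrite /= /single_fun; case: pselect => // e; rewrite e eqxx in ji.
Qed.

Lemma single_additive i : additive_map (@single I V i).
Proof.
move=> x y; apply: dsum_ext => j; rewrite dsum_addE.
have [->|ji] := eqVneq j i; first by rewrite !single_eq.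
by rewrite !single_neq ?addr0.
Qed.

Lemma dlift_single G i x : (forall i, additive_map (G i)) ->
  dlift G (single i x) = G i x.
Proof.
move=> Gadd; rewrite /dlift (fsum_single (i := i)) ?single_eq // => j ji.
by rewrite single_neq // additive_map0.
Qed.

Lemma dlift_additive G : (forall i, additive_map (G i)) ->
  additive_map (dlift G).
Proof.
move=> Gadd.
have fin z : finite_set [set i | G i (z i) != 0]%classic.
  apply: sub_finite_set (dsum_finite z) => i /=; apply: contra => /eqP zi.
  by rewrite zi (additive_map0 (Gadd i)).
by move=> x y; rewrite /dlift -fsum_add //; apply: eq_fsbigr => i _ /=; rewrite Gadd.
Qed.

Lemma dsum_applyE (i : I) : additive_map (fun z : dsum V => z i).
Proof. by []. Qed.

Lemma dsum_sum_single z : \sum_(i \in [set: I]%classic) single i (z i) = z.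
Proof.
apply: dsum_ext => j.
rewrite (additive_map_fsum (dsum_applyE j)).
  rewrite (fsum_single (i := j)) ?single_eq // => k kj.
  by rewrite single_neq // eq_sym.
apply: sub_finite_set (dsum_finite z) => i /=; apply: contra => /eqP zi.
by rewrite zi (additive_map0 (single_additive (i := i))).
Qed.

Lemma dlift_comp_single (h : dsum V -> W) z : additive_map h ->
  dlift (fun i x => h (single i x)) z = h z.
Proof.
move=> h_add; rewrite -[in RHS](dsum_sum_single z) (additive_map_fsum h_add) //.
apply: sub_finite_set (dsum_finite z) => i /=; apply: contra => /eqP zi.
by rewrite zi (additive_map0 (single_additive (i := i))).
Qed.

End DirectSumTheory.

Section QuotientTheory.
Variables (V W : zmodType) (S : set V).

Lemma qclass_additive : additive_map (qclass S).
Proof.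
by move=> x y; rewrite /qclass; apply: (raddfD (\pi_(Quotient.quot (in_generated S)))).
Qed.

Lemma qclass_repr (q : quot_by S) :
  qclass S (repr (q : Quotient.quot (in_generated S))) = q.
Proof. exact: reprK. Qed.

Lemma qclass_generator x : S x -> qclass S x = 0.
Proof.
move=> Sx; rewrite -(additive_map0 qclass_additive); apply/eqP.
rewrite /qclass -Quotient.idealrBE subr0; apply/asboolP => P _ _ SP.
exact: SP.
Qed.

(** The kernel of [f] is a subgroup containing [S], hence contains the difference between [x] and
    the chosen representative of its class. *)
Lemma descend_qclass (f : V -> W) x :
  additive_map f -> (forall y, S y -> f y = 0) -> descend f (qclass S x) = f x.
Proof.
move=> f_add fS; rewrite /descend.
set y := repr _; have : qclass S y = qclass S x by rewrite qclass_repr.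
move/eqP; rewrite /qclass -Quotient.idealrBE => /asboolP H.
apply/eqP; rewrite -subr_eq0 -additive_mapB //; apply/eqP.
apply: (H (fun z => f z = 0)) => [|u v fu fv|//]; first exact: additive_map0.
by rewrite additive_mapB // fu fv subr0.
Qed.

Lemma descend_additive (f : V -> W) :
  additive_map f -> (forall y, S y -> f y = 0) ->
  additive_map (descend f : quot_by S -> W).
Proof.
move=> f_add fS p q; rewrite -[p]qclass_repr -[q]qclass_repr.
by rewrite -qclass_additive !descend_qclass.
Qed.

End QuotientTheory.

(** * Graded maps and Koszul signs *)

Definition graded_map (A B : complex) (f : A -> B) : Prop :=
  additive_map f /\ forall p (x : A), hdeg p x -> hdeg p (f x).

Section Homogeneous.
Variables (A : complex) (A_cpx : is_complex A).

Lemma part_hdeg p (x : A) : hdeg p (part p x).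
Proof. by rewrite /hdeg part_part // eqxx. Qed.

Lemma homogeneous_ind (P : A -> Prop) :
  P 0 -> (forall x y, P x -> P y -> P (x + y)) ->
  (forall p x, hdeg p x -> P x) -> forall x, P x.
Proof.
move=> P0 PD Ph x; rewrite -(part_sum A_cpx x).
have [r _ ->//] := finite_fsum (part_finite A_cpx x).
by apply: big_ind => // p _; apply: Ph (part_hdeg p x).
Qed.

Lemma koszul_hdeg k p (x : A) :
  hdeg p x -> koszul k x = x *~ (-1) ^+ (k * `|p|)%N.
Proof.
move=> hx; rewrite /koszul (fsum_single (i := p)) ?hx // => q qp.
by rewrite -hx part_part // (negbTE qp) mul0rz.
Qed.

Lemma koszul_additive k : additive_map (@koszul A k).
Proof.
move=> x y; rewrite /koszul -fsum_add.
- by apply: eq_fsbigr => p _; rewrite part_additive // mulrzDl.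
- apply: sub_finite_set (part_finite A_cpx x) => p /=; apply: contra => /eqP->.
  by rewrite mul0rz.
- apply: sub_finite_set (part_finite A_cpx y) => p /=; apply: contra => /eqP->.
  by rewrite mul0rz.
Qed.

Lemma koszul0 (x : A) : koszul 0 x = x.
Proof.
rewrite -[RHS](part_sum A_cpx); apply: eq_fsbigr => p _.
by rewrite mul0n expr0 mulr1z.
Qed.

End Homogeneous.

Lemma koszul_degree0 (A : complex) (A_cpx : is_complex A) k (x : A) :
  hdeg 0 x -> koszul k x = x.
Proof. by move=> /(koszul_hdeg A_cpx k)->; rewrite absz0 muln0 expr0 mulr1z. Qed.

Section GradedMaps.
Variables (A B : complex) (A_cpx : is_complex A) (B_cpx : is_complex B).
Variables (f : A -> B) (f_graded : graded_map f).

Lemma graded_map_part p (x : A) : f (part p x) = part p (f x).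
Proof.
have [f_add f_deg] := f_graded.
elim/(homogeneous_ind A_cpx): x => [|x y fx fy|q x hx].
- rewrite (additive_map0 (part_additive A_cpx p)) (additive_map0 f_add).
  by rewrite (additive_map0 (part_additive B_cpx p)).
- rewrite f_add (part_additive A_cpx) (part_additive B_cpx) f_add.
  by rewrite fx fy.
- have hfx : part q (f x) = f x by apply: f_deg.
  rewrite -hfx -{1}hx (part_part A_cpx) (part_part B_cpx).
  by case: eqP => _; rewrite ?hx ?hfx ?(additive_map0 f_add).
Qed.

Lemma graded_map_koszul k (x : A) : f (koszul k x) = koszul k (f x).
Proof.
have [f_add f_deg] := f_graded.
elim/(homogeneous_ind A_cpx): x => [|x y fx fy|q x hx].
- rewrite (additive_map0 (koszul_additive A_cpx k)) (additive_map0 f_add).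
  by rewrite (additive_map0 (koszul_additive B_cpx k)).
- rewrite f_add (koszul_additive A_cpx) (koszul_additive B_cpx) f_add.
  by rewrite fx fy.
- rewrite (koszul_hdeg A_cpx k hx) (koszul_hdeg B_cpx k (f_deg _ _ hx)).
  by rewrite additive_map_mulrz.
Qed.

(** Injective graded maps reflect degrees because they commute with [part]. Applied to [inc], this
    gives the degrees of values of [ret], which is only given as an inverse map. *)
Lemma graded_map_hdegK p (x : A) : injective f -> hdeg p (f x) -> hdeg p x.
Proof. by move=> f_inj hfx; apply: f_inj; rewrite graded_map_part. Qed.

End GradedMaps.

(** As -1 is its own inverse, the absolute value may be dropped; signs then add up along sums of
    integer degrees. *)
Lemma signr_absz (p : int) : (-1) ^+ `|p|%N = (-1) ^ p :> int.
Proof. by case: p => n //; rewrite NegzE abszN exprzN exprnN invr_sign. Qed.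

Lemma pairing_koszul (A B C : complex) (A_cpx : is_complex A)
    (B_cpx : is_complex B) (C_cpx : is_complex C) (f : A -> B -> C) :
  chain_pairing f -> forall k x y,
  koszul k (f x y) = f (koszul k x) (koszul k y).
Proof.
move=> f_pair k x y; have fl := cp_additivel f_pair; have fr := cp_additiver f_pair.
have K0 (D : complex) (DC : is_complex D) := additive_map0 (koszul_additive DC k).
elim/(homogeneous_ind A_cpx): x => [|x x' IH IH'|p x hx].
- by rewrite (K0 A) // !(additive_map0 (fl _)) (K0 C).
- by rewrite (fl _ x x') !koszul_additive // (fl _ (koszul k x)) IH IH'.
elim/(homogeneous_ind B_cpx): y => [|y y' IH IH'|q y hy].
- by rewrite (K0 B) // !(additive_map0 (fr _)) (K0 C).
- by rewrite fr !koszul_additive // fr IH IH'.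
have hxy := cp_degree f_pair hx hy.
rewrite (koszul_hdeg A_cpx k hx) (koszul_hdeg B_cpx k hy).
rewrite (koszul_hdeg C_cpx k hxy) additive_map_mulrz //.
rewrite (additive_map_mulrz (fl y)) -mulrzA; congr (_ *~ _).
by rewrite ![(k * _)%N]mulnC !exprM -exprMn !signr_absz -exprzDr.
Qed.

(** * Generators of Hochschild complexes *)

Section Generators.
Variables (D : mon_data nat).

Lemma hsingle_additive unital (i : forall m n, ainf unital m n -> D m n)
    (Psi : fun_data D) m n : additive_map (@hsingle unital D i Psi m n).
Proof.
case: unital i => i x y; last exact: single_additive.
by rewrite /hsingle (single_additive (i := n)) qclass_additive.
Qed.

Lemma hpure_additive unital (i : forall m n, ainf unital m n -> D m n)
    (Psi : fun_data D) n ks m : additive_map (@hpure unital D i Psi n ks m).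
Proof.
elim: n ks m => [|n IH] [|k ks] m x y //=; rewrite ?addr0 //.
by rewrite IH hsingle_additive.
Qed.

Lemma hpure_size unital (i : forall m n, ainf unital m n -> D m n)
    (Psi : fun_data D) n ks m (x : Psi (ksum ks m)) :
  size ks <> n -> hpure i n ks x = 0.
Proof.
elim: n ks m x => [|n IH] [|k ks] m x //= kn.
rewrite IH => [|ekn]; last by rewrite ekn in kn.
exact: (additive_map0 (@hsingle_additive _ i (hochn i n Psi) m k)).
Qed.

(** In the reduced case the family comes from [h \o qclass], whose value at the chosen
    representative of [z] is [h z] again. *)
Lemma hlift_hsingle unital (i : forall m n, ainf unital m n -> D m n)
    (Psi : fun_data D) m (W : zmodType) (h : hochschild i Psi m -> W) z :
  additive_map h -> hlift i (fun k x => h (hsingle i k x)) z = h z.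
Proof.
case: unital i h z => i h z h_add; last exact: dlift_comp_single.
rewrite /hlift /hsingle /descend.
rewrite (dlift_comp_single (h := h \o qclass _)) /= ?qclass_repr //.
by move=> x y /=; rewrite qclass_additive h_add.
Qed.

(** The working form of the fact that generators span: an additive [h] is recovered from its values
    on them. It is mostly used from right to left, to expand an element in generators. *)
Lemma hliftn_hpure unital (i : forall m n, ainf unital m n -> D m n)
    (Psi : fun_data D) n m (W : zmodType) (h : hochn i n Psi m -> W) z :
  additive_map h -> hliftn i n (fun ks x => h (hpure i n ks x)) z = h z.
Proof.
elim: n m h z => [|n IH] m h z h_add //=.
rewrite -[RHS]hlift_hsingle //; congr (hlift i _ z).
apply: functional_extensionality_dep => k.
apply: functional_extensionality_dep => y.
apply: (IH (k.+1 + m)%R (h \o @hsingle unital D i (hochn i n Psi) m k) y) => u v.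
by rewrite /ssrfun.comp hsingle_additive h_add.
Qed.

Lemma eq_hliftn unital (i : forall m n, ainf unital m n -> D m n)
    (Psi : fun_data D) n m (W : zmodType)
    (G G' : forall ks, Psi (ksum ks m) -> W) (z : hochn i n Psi m) :
  (forall ks x, G ks x = G' ks x) -> hliftn i n G z = hliftn i n G' z.
Proof.
move=> GG'; congr (hliftn i n _ z).
by apply: functional_extensionality_dep => ks; apply: functional_extensionality_dep.
Qed.

End Generators.

Lemma hochschild_ind unital (D : mon_data nat)
    (i : forall m n, ainf unital m n -> D m n)
    (Psi : fun_data D) m (W : zmodType) (h h' : hochschild i Psi m -> W) :
  additive_map h -> additive_map h' ->
  (forall k x, h (hsingle i k x) = h' (hsingle i k x)) -> h =1 h'.
Proof.
move=> h_add h'_add hh' z.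
rewrite -(hlift_hsingle z h_add) -(hlift_hsingle z h'_add).
congr (hlift i _ z); apply: functional_extensionality_dep => k.
exact: functional_extensionality_dep.
Qed.

(** * Naturality of the Hochschild construction *)

(** The part of the functor laws that passes to Hochschild complexes without any identity between
    the coefficients f_{n,k}; laws on the differential would bring those in. *)
Record weak_functor (D : mon_data nat) (Psi : fun_data D) : Prop := {
  weak_additive : forall m n (f : D m n), additive_map (fun x => act Psi x f);
  weak_comp : forall m n p (x : Psi m) (f : D m n) (g : D n p),
    act Psi (act Psi x f) g = act Psi x (comp D f g) }.

(** Without conditions on degree or differential, so that composition with a fixed morphism, or the
    action on a fixed element, of any degree is included. *)
Record natural (D : mon_data nat) (Psi Psi' : fun_data D)
    (F : forall m, Psi m -> Psi' m) : Prop := {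
  natural_additive : forall m, additive_map (F m);
  natural_act : forall m n (x : Psi m) (f : D m n),
    F n (act Psi x f) = act Psi' (F m x) f }.

Section Interchange.
Variables (Ob : nmodType) (D : mon_data Ob) (D_mon : is_mon_category D).

Lemma koszul_idm k a : koszul k (idm D a) = idm D a.
Proof.
by rewrite (koszul_degree0 (mon_complex D_mon _ _)) //; apply: mon_id_degree.
Qed.

Lemma koszul_comp k a b c (f : D a b) (g : D b c) :
  koszul k (comp D f g) = comp D (koszul k f) (koszul k g).
Proof.
have C := mon_complex D_mon.
exact: (pairing_koszul (C _ _) (C _ _) (C _ _) (mon_comp D_mon a b c)).
Qed.

(** For [f'] of degree 0 the interchange sign is 1 whatever the degree of [g], so the law extends
    additively to inhomogeneous [g]. *)
Lemma interchange_degree0 a b c a' b' c'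
    (f : D a b) (g : D a' b') (f' : D b c) (g' : D b' c') :
  hdeg 0 f' ->
  comp D (tens D f g) (tens D f' g') = tens D (comp D f f') (comp D g g').
Proof.
move=> f'0.
elim/(homogeneous_ind (mon_complex D_mon a' b')): g => [|x y IHx IHy|p g hg].
- have tr a1 b1 a2 b2 (h : D a1 b1) :=
    additive_map0 (cp_additiver (mon_tens D_mon a1 b1 a2 b2) h).
  have cl a1 b1 c1 (h : D b1 c1) :=
    additive_map0 (cp_additivel (mon_comp D_mon a1 b1 c1) h).
  by rewrite tr cl (cl _ _ _ g') tr.
- rewrite (cp_additiver (mon_tens D_mon _ _ _ _)).
  rewrite (cp_additivel (mon_comp D_mon _ _ _)) IHx IHy.
  rewrite -(cp_additiver (mon_tens D_mon _ _ _ _)).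
  by rewrite -(cp_additivel (mon_comp D_mon _ _ _)).
- by rewrite (mon_interchange D_mon _ _ hg f'0) /ksign absz0 muln0 expr0 mulr1z.
Qed.

End Interchange.

Section Naturality.
Variables (unital : bool) (D : mon_data nat) (D_mon : is_mon_category D).
Variable i : forall m n, ainf unital m n -> D m n.
Hypothesis i_degree0 : forall m n (x : ainf unital m n), hdeg 0 x -> hdeg 0 (i x).

Lemma unit_forest_degree n j : hdeg 0 (unit_forest unital n j).
Proof.
have leaves s : sumn [seq tree_degree t | t <- map PLeaf s] = 0%N by elim: s.
rewrite /hdeg /unit_forest /fterm; case: insubP => [F _ eF|_] /=.
  rewrite dlift_single => [|F' x y]; last first.
    by case: eqP => _; rewrite ?addr0 // single_additive.
  by rewrite eF /forest_degree map_cat sumn_cat /= !leaves.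
(* Here the list is not an admissible forest, as for [j] too large or without units; [fterm] is then
   0, which is homogeneous of every degree. *)
by rewrite (additive_map0 (dlift_additive _)) // => F' x y;
  case: eqP => _; rewrite ?addr0 // single_additive.
Qed.

Lemma hoch_act_single (Psi : fun_data D) (Psi_weak : weak_functor Psi) m m'
    n x (f : D m m') :
  hoch_act (i := i) (single n x : hoch_val i Psi m) f =
  single n (act Psi x (tens D (idm D n.+1) (koszul n f))).
Proof.
rewrite /hoch_act dlift_single // => k y z.
by rewrite (weak_additive Psi_weak) single_additive.
Qed.

Lemma hoch_act_additive (Psi : fun_data D) (Psi_weak : weak_functor Psi) m m'
    (f : D m m') : additive_map (fun z : hoch_val i Psi m => hoch_act z f).
Proof.
apply: dlift_additive => k y z.
by rewrite (weak_additive Psi_weak) single_additive.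
Qed.

(** The unit enters among the first strands and [f] acts on the last ones, so the two commute; the
    unit has degree 0, hence no sign. The new witness is [y] acted on by [f] before the
    insertion. *)
Lemma hoch_act_degenerate (Psi : fun_data D) (Psi_weak : weak_functor Psi) m m'
    (f : D m m') (z : hoch_val i Psi m) :
  degenerate i (Phi := Psi) (m := m) z ->
  degenerate i (Phi := Psi) (m := m') (hoch_act z f).
Proof.
move=> [n [j [y [nj ->]]]]; exists n, j.
exists (act Psi y (tens D (idm D n) (koszul n f))); split => //.
rewrite (hoch_act_single Psi_weak) !(weak_comp Psi_weak).
have u0 := i_degree0 (unit_forest_degree n j).
rewrite (interchange_degree0 D_mon _ _ _ (mon_id_degree D_mon n.+1)).
rewrite (interchange_degree0 D_mon _ _ _ u0).
have u1 := mon_comp1r D_mon (i (unit_forest unital n j)).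
rewrite (mon_comp1l D_mon (i (unit_forest unital n j))) u1.
by rewrite (mon_comp1l D_mon (koszul n f)) (mon_comp1r D_mon (koszul n f)).
Qed.

Lemma rhoch_act_qclass (Psi : fun_data D) (Psi_weak : weak_functor Psi) m m'
    (z : hoch_val i Psi m) (f : D m m') :
  act (rhoch i Psi) (qclass (degenerate i (Phi := Psi) (m := m)) z) f =
  qclass (degenerate i (Phi := Psi) (m := m')) (hoch_act z f).
Proof.
apply: descend_qclass => [x y|x dx].
  by rewrite (hoch_act_additive Psi_weak) qclass_additive.
exact/qclass_generator/hoch_act_degenerate.
Qed.

Lemma rhoch_act_additive (Psi : fun_data D) (Psi_weak : weak_functor Psi) m m'
    (f : D m m') : additive_map (fun z : rhoch i Psi m => act (rhoch i Psi) z f).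
Proof.
apply: (descend_additive (f := fun z : hoch_val i Psi m =>
  qclass (degenerate i (Phi := Psi) (m := m')) (hoch_act z f))) => [x y|x dx].
  by rewrite (hoch_act_additive Psi_weak) qclass_additive.
exact/qclass_generator/hoch_act_degenerate.
Qed.

End Naturality.

Section NaturalMaps.
Variables (unital : bool) (D : mon_data nat) (D_mon : is_mon_category D).
Variable i : forall m n, ainf unital m n -> D m n.
Hypothesis i_degree0 : forall m n (x : ainf unital m n), hdeg 0 x -> hdeg 0 (i x).

Lemma act_hsingle (Psi : fun_data D) (Psi_weak : weak_functor Psi) m m'
    n x (f : D m m') :
  act (hochschild i Psi) (hsingle i n x) f =
  hsingle i n (act Psi x (tens D (idm D n.+1) (koszul n f))).
Proof.
case: unital i i_degree0 => j j_degree0; last exact: hoch_act_single.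
by rewrite [LHS]rhoch_act_qclass // hoch_act_single.
Qed.

Lemma hochschild_weak_functor (Psi : fun_data D) :
  weak_functor Psi -> weak_functor (hochschild i Psi).
Proof.
move=> Psi_weak.
have act_add m n (f : D m n) :
    additive_map (fun x => act (hochschild i Psi) x f).
  case: unital i i_degree0 => j j_degree0; last exact: hoch_act_additive.
  exact: rhoch_act_additive.
split=> // m n p x f g; move: x.
apply: (hochschild_ind
  (h := fun x => act (hochschild i Psi) (act (hochschild i Psi) x f) g)
  (h' := fun x => act (hochschild i Psi) x (comp D f g))) => [x y|x y|k x].
- by rewrite !act_add.
- by rewrite act_add.
rewrite !act_hsingle // (weak_comp Psi_weak) interchange_degree0 //.
  by rewrite (mon_comp1l D_mon) -koszul_comp.
exact: mon_id_degree.
Qed.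

Lemma hsingle_degenerate (Psi : fun_data D) m n j (y : Psi (n + m)%R) :
  unital -> (0 < j <= n)%N ->
  hsingle i n (act Psi y (tens D (i (unit_forest unital n j)) (idm D m))) = 0.
Proof.
case: unital i => // i0 _ jn; rewrite /hsingle; apply: qclass_generator.
by exists n, j, y.
Qed.

(** The criterion for [hlift] to be the induced map also in the reduced case: a family killing
    inserted units does not depend on the representative. *)
Lemma hlift_well_defined (Psi : fun_data D) m (W : zmodType)
    (G : forall k, Psi (k.+1 + m)%R -> W) :
  (forall k, additive_map (G k)) ->
  (unital -> forall n j (y : Psi (n + m)%R), (0 < j <= n)%N ->
     G n (act Psi y (tens D (i (unit_forest unital n j)) (idm D m))) = 0) ->
  additive_map (hlift i G) /\ forall k x, hlift i G (hsingle i k x) = G k x.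
Proof.
move=> G_add; case: unital i => i0 Gd; last first.
  by split=> [|k x]; [exact: dlift_additive | exact: dlift_single].
have G0 z : degenerate i0 (Phi := Psi) (m := m) z -> dlift G z = 0.
  by move=> [n [j [y [jn ->]]]]; rewrite dlift_single // Gd.
have dG := dlift_additive G_add.
split=> [|k x]; first exact: descend_additive.
by rewrite [LHS]descend_qclass ?dlift_single.
Qed.

Definition hoch_map (Psi Psi' : fun_data D) (F : forall m, Psi m -> Psi' m) m
    (z : hochschild i Psi m) : hochschild i Psi' m :=
  hlift i (fun k x => hsingle i k (F (k.+1 + m)%R x)) z.

Section HochMap.
Variables (Psi Psi' : fun_data D).
Hypotheses (Psi_weak : weak_functor Psi) (Psi'_weak : weak_functor Psi').
Variable F : forall m, Psi m -> Psi' m.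
Hypothesis F_nat : natural F.

Lemma hoch_map_props m :
  additive_map (@hoch_map Psi Psi' F m) /\
  forall k x, hoch_map F (hsingle i k x) = hsingle i k (F x) :> hochschild i Psi' m.
Proof.
apply: hlift_well_defined => [k x y|ul n j y jn].
  by rewrite (natural_additive F_nat) hsingle_additive.
by rewrite (natural_act F_nat) hsingle_degenerate.
Qed.

Lemma hoch_map_natural : natural (@hoch_map Psi Psi' F).
Proof.
have add m := (hoch_map_props m).1; have hs m := (hoch_map_props m).2.
split=> // m n x f; move: x.
have [Wadd _] := hochschild_weak_functor Psi_weak.
have [Wadd' _] := hochschild_weak_functor Psi'_weak.
apply: (hochschild_ind (h := fun x => hoch_map F (act (hochschild i Psi) x f))
  (h' := fun x => act (hochschild i Psi') (hoch_map F x) f)) => [x y|x y|k x].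
- by rewrite Wadd add.
- by rewrite add Wadd'.
by rewrite act_hsingle // !hs act_hsingle // (natural_act F_nat).
Qed.

End HochMap.

Section HochnMap.
Variables (Psi Psi' : fun_data D).
Hypotheses (Psi_weak : weak_functor Psi) (Psi'_weak : weak_functor Psi').
Variable F : forall m, Psi m -> Psi' m.
Hypothesis F_nat : natural F.

Lemma hochn_weak_functor n (Phi : fun_data D) :
  weak_functor Phi -> weak_functor (hochn i n Phi).
Proof. by move=> PhiW; elim: n => //= n; apply: hochschild_weak_functor. Qed.

(** Both claims are proved together: evaluation on the generators of the next layer needs its
    well-definedness, and this follows from naturality of the layers inside. *)
Lemma hochn_map_natural n :
  natural (fun m => @hochn_map unital D D i i Psi Psi' F n m) /\
  forall ks m (x : Psi (ksum ks m)),
    hochn_map i i F n (hpure i n ks x) = hpure i n ks (F x).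
Proof.
elim: n => [|n [IHnat IHpure]].
  split=> [|[|k ks] m x] //=; rewrite /hochn_map /=.
  exact: (additive_map0 (@natural_additive _ _ _ _ F_nat m)).
pose H m := @hochn_map unital D D i i Psi Psi' F n m.
(* [hochn_map] goes through all layers at once. Expanding the inner element in generators turns it
   into one layer of [hoch_map] around the previous stage, to which naturality applies. *)
have E m z : @hochn_map unital D D i i Psi Psi' F n.+1 m z =
    @hoch_map (hochn i n Psi) (hochn i n Psi') H m z.
  rewrite /hochn_map /hoch_map /=; congr (hlift i _ z).
  apply: functional_extensionality_dep => k.
  apply: functional_extensionality_dep => y.
  rewrite -/(hochn_map i i F n y).
  rewrite -(hliftn_hpure y (h := fun y => hsingle i k (hochn_map i i F n y))).
    by apply: eq_hliftn => ks x; rewrite IHpure.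
  by move=> u v; rewrite (natural_additive IHnat) hsingle_additive.
have wn := hochn_weak_functor n Psi_weak.
have wn' := hochn_weak_functor n Psi'_weak.
have HE : (fun m => @hochn_map unital D D i i Psi Psi' F n.+1 m) =
    @hoch_map (hochn i n Psi) (hochn i n Psi') H.
  by apply: functional_extensionality_dep => m; apply: functional_extensionality_dep.
split; first by rewrite HE; apply: hoch_map_natural.
move=> ks m x; rewrite E.
have [add hs] := hoch_map_props IHnat m.
case: ks x => [|k ks] x /=; first exact: additive_map0.
by rewrite hs IHpure.
Qed.

End HochnMap.

End NaturalMaps.

(** * Pullback of functors *)

(** Transport along an equality of functors, not just of their values, so that it commutes with the
    action of morphisms. *)
Definition fcast (D : mon_data nat) (A B : fun_data D) (e : A = B) m
    (x : A m) : B m := ecast C (C m) e x.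

Lemma fcast_additive (D : mon_data nat) (A B : fun_data D) (e : A = B) m :
  additive_map (@fcast D A B e m).
Proof. by case: _ / e. Qed.

Section Pullback.
Variables (unital : bool) (D D' : mon_data nat).
Variable i : forall m n, ainf unital m n -> D m n.
Variable i' : forall m n, ainf unital m n -> D' m n.
Variable R : forall m n, D m n -> D' m n.

Definition fun_pullback (Psi : fun_data D') : fun_data D :=
  @FunData D Psi (fun m n x f => act Psi x (R f)).

Hypothesis R_id : forall m, R (idm D m) = idm D' m.
Hypothesis R_tens : forall a b a' b' (f : D a b) (g : D a' b'),
  R (tens D f g) = tens D' (R f) (R g).
Hypothesis R_koszul : forall k m n (f : D m n), R (koszul k f) = koszul k (R f).
Hypothesis R_mult : forall m n (a : ainf unital m n), i' a = R (i a).

(* The equality of the two functors also matches [hlift] in the reduced case,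
   where [hlift] evaluates at chosen representatives: no well-definedness of
   the family [G] is needed. *)
Lemma hochschild_fun_pullback (Psi : fun_data D') :
  exists e : hochschild i (fun_pullback Psi) = fun_pullback (hochschild i' Psi),
    (forall m n x,
       fcast e (@hsingle _ _ i (fun_pullback Psi) m n x) =
       @hsingle _ _ i' Psi m n x) /\
    (forall m (W : zmodType) (G : forall n, Psi (n.+1 + m)%R -> W) z,
       @hlift _ _ i (fun_pullback Psi) m W G z =
       @hlift _ _ i' Psi m W G (fcast e z)).
Proof.
pose G m : zmodType := dsum (fun n : nat => Psi (n.+1 + m)%R : zmodType).
pose P m p : G m -> G m := dlift (fun n (x : Psi (n.+1 + m)%R) =>
       single n (part (p - n%:Z) x)).
have Ed : (fun m => @diff (hoch_val i (fun_pullback Psi) m)) =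
          (fun m => @diff (hoch_val i' Psi m)).
  apply: functional_extensionality_dep => m.
  apply: functional_extensionality_dep => z.
  congr (dlift _ z).
  apply: functional_extensionality_dep => n.
  apply: functional_extensionality_dep => x.
  congr (_ + _); apply: eq_bigr => k _.
  by congr (single _ _); rewrite /= R_tens R_id R_mult.
have Ea : (fun m m' z f => @hoch_act _ _ i (fun_pullback Psi) m m' z f) =
          (fun m m' z f => @hoch_act _ _ i' Psi m m' z (R f)).
  do 4! apply: functional_extensionality_dep => ?.
  congr (dlift _ _).
  apply: functional_extensionality_dep => n.
  apply: functional_extensionality_dep => x.
  by congr (single _ _); rewrite /= R_tens R_id R_koszul.
have Es : (fun m => degenerate i (Phi := fun_pullback Psi) (m := m)) =
          (fun m => degenerate i' (Phi := Psi) (m := m)).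
  apply: functional_extensionality_dep => m; apply/seteqP.
  by split=> z [n [j [y [nj ->]]]]; exists n, j, y; split;
    rewrite //= R_tens R_id R_mult.
(* Both functors are instances of [U], or of [Q] in the reduced case, at equal arguments. With these
   abstracted the equations can be eliminated, and the required equality becomes [erefl]. *)
pose U (d : forall m, G m -> G m)
     (a : forall m m', G m -> D m m' -> G m') : fun_data D :=
  @FunData D (fun m => @Complex (G m) (@P m) (d m)) a.
pose Q (S : forall m, set (G m)) (d : forall m, G m -> G m)
     (a : forall m m', G m -> D m m' -> G m') : fun_data D :=
  @FunData D (fun m => @Complex (quot_by (S m))
     (fun p => descend (fun z => qclass (S m) (@P m p z)))
     (descend (fun z => qclass (S m) (d m z))))
    (fun m m' z f => descend (fun z => qclass (S m') (a m m' z f)) z).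
case: unital i i' R_mult Ed Ea Es => j j' R_mult' Ed Ea Es.
- suff H S1 S2 d1 d2 a1 a2 : S1 = S2 -> d1 = d2 -> a1 = a2 ->
    exists e : Q S1 d1 a1 = Q S2 d2 a2,
      (forall m n x, fcast e (qclass (S1 m) (single n x) : Q S1 d1 a1 m) =
        qclass (S2 m) (single n x)) /\
      (forall m (W : zmodType) (K : forall n, Psi (n.+1 + m)%R -> W) z,
        descend (dlift K) (z : Q S1 d1 a1 m) =
        descend (dlift K) (fcast e z : Q S2 d2 a2 m)).
    exact: H Es Ed Ea.
  by move=> -> -> ->; exists erefl.
- suff H d1 d2 a1 a2 : d1 = d2 -> a1 = a2 ->
    exists e : U d1 a1 = U d2 a2,
      (forall m n x, fcast e (single n x : U d1 a1 m) = single n x) /\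
      (forall m (W : zmodType) (K : forall n, Psi (n.+1 + m)%R -> W) z,
        dlift K (z : U d1 a1 m) = dlift K (fcast e z : U d2 a2 m)).
    exact: H Ed Ea.
  by move=> -> ->; exists erefl.
Qed.

Lemma hochn_fun_pullback (Psi : fun_data D') n :
  exists e : hochn i n (fun_pullback Psi) = fun_pullback (hochn i' n Psi),
    (forall m ks x,
       fcast e (@hpure _ _ i (fun_pullback Psi) n ks m x) =
       @hpure _ _ i' Psi n ks m x) /\
    (forall m (W : zmodType) (G : forall ks, Psi (ksum ks m) -> W) z,
       @hliftn _ _ i (fun_pullback Psi) n m W G z =
       @hliftn _ _ i' Psi n m W G (fcast e z)).
Proof.
elim: n => [|n [e [IHpure IHlift]]]; first by exists erefl; split=> // m [].
(* The inner functor is generalized to a variable [A] so that the equality from the induction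
   hypothesis can be eliminated. *)
have step (A : fun_data D) (B : fun_data D') (e0 : A = fun_pullback B) :
  exists e1 : hochschild i A = fun_pullback (hochschild i' B),
    (forall m k x, fcast e1 (@hsingle _ _ i A m k x) =
       @hsingle _ _ i' B m k (fcast e0 x)) /\
    (forall m (W : zmodType) (G : forall n, A (n.+1 + m)%R -> W)
        (G' : forall n, B (n.+1 + m)%R -> W) z,
       (forall k x, G k x = G' k (fcast e0 x)) ->
       hlift i G z = hlift i' G' (fcast e1 z)).
  subst A; have [e1 [hs hl]] := hochschild_fun_pullback B.
  exists e1; split=> [//|m W G G' z GG']; rewrite hl; congr (hlift i' _ _).
  by apply: functional_extensionality_dep => k; apply: functional_extensionality_dep.
have [e1 [hs hl]] := step _ _ e; exists e1; split=> [m ks x|m W G z].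
  case: ks x => [|k ks] x /=; last by rewrite hs IHpure.
  exact: (additive_map0 (@fcast_additive _ _ _ e1 m)).
by apply: hl => k x; apply: IHlift.
Qed.

End Pullback.

(** * Tensor products of generators *)

Section Casts.
Variables (Ob : nmodType) (D : mon_data Ob).

Lemma hcast_id a b (ea : a = a) (eb : b = b) (f : D a b) : hcast ea eb f = f.
Proof. by rewrite (Prop_irrelevance ea erefl) (Prop_irrelevance eb erefl). Qed.

Lemma comp_hcast_idm (D_mon : is_mon_category D) a b c (e : b = c) (f : D a b) :
  comp D f (hcast erefl e (idm D b)) = hcast erefl e f.
Proof. by case: _ / e; rewrite (mon_comp1r D_mon). Qed.

Lemma hcast_additive a a' b b' (ea : a = a') (eb : b = b') :
  additive_map (fun f : D a b => hcast ea eb f).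
Proof. by subst a' b'. Qed.

Lemma comp_hcast a b b' c c' (e : b = b') (e' : c = c') (f : D a b) (g : D b c) :
  comp D (hcast erefl e f) (hcast e e' g) = hcast erefl e' (comp D f g).
Proof. by subst b' c'. Qed.

End Casts.

Section SymmetryUnit.
Variables (D : mon_data nat) (D_mon : is_mon_category D).
Variables (s : forall a b, D (a + b) (b + a)) (s_sym : is_symmetry s).

(* For [h] a symmetry [s m 0], the second hypothesis is the hexagon: it says that
   the isomorphism [h] is idempotent. *)
Lemma idempotent_iso a b (e : a = b) (h : D a b) (g : D b a)
    (ea : (a + 0)%R = a) (eb : (b + 0)%R = a) (ec : b = b) :
  comp D h g = idm D a ->
  comp D (hcast ea eb (tens D h (idm D 0)))
    (hcast (erefl a) ec (tens D (idm D 0) h)) = h ->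
  h = hcast erefl e (idm D a).
Proof.
subst b => hg; rewrite (mon_tens0r D_mon) (mon_tens0l D_mon) => hh.
have : comp D (comp D h h) g = comp D h g by rewrite hh.
by rewrite (mon_compA D_mon) hg (mon_comp1r D_mon) hcast_id.
Qed.

(** The hexagon for m, 0, 0: since 0 + 0 reduces to 0, all three symmetries in it are [s m 0]. *)
Lemma sym_unitr (m : nat) (e : (m + 0 = 0 + m :> nat)%R) :
  s m 0 = hcast erefl e (idm D (m + 0)%R).
Proof.
have ea : ((m + 0) + 0 = m + (0 + 0) :> nat)%R by rewrite !addr0.
have eb : ((0 + m) + 0 = 0 + (m + 0) :> nat)%R by rewrite addrA.
have ec : (0 + (0 + m) = (0 + 0) + m :> nat)%R by rewrite addrA.
exact: (@idempotent_iso (m + 0)%R (0 + m)%R e (s m 0) (s 0 m) ea eb ec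
  (sym_inv s_sym m 0) (sym_hexagon s_sym ea eb ec)).
Qed.

Lemma sym_unitl (m : nat) (e : (0 + m = m + 0 :> nat)%R) :
  s 0 m = hcast erefl e (idm D (0 + m)%R).
Proof.
have inv a b (e1 : a = b) (e2 : b = a) (g : D b a) :
    comp D (hcast erefl e1 (idm D a)) g = idm D a -> g = hcast erefl e2 (idm D b).
  by subst b; rewrite !hcast_id (mon_comp1l D_mon).
apply: (inv _ _ (esym e)); rewrite -sym_unitr; exact: (sym_inv s_sym).
Qed.

End SymmetryUnit.

Section Shuffle.
Variables (unital : bool) (E : mult_prop unital).

Lemma shuffle_idm ks ls m m'
    (e : (m + sumn (map succn ls))%R = (sumn (map succn ls) + m)%R)
    (e' : (ksum ks m + ksum ls m')%R = ksum (ls ++ ks) (m + m')%R) :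
  prop_sym E m (sumn (map succn ls)) = hcast erefl e (idm E _) ->
  shuffle E ks ls m m' = hcast erefl e' (idm E _).
Proof.
rewrite /shuffle => ->; move: (shuffle_dom _ _ _ _) (shuffle_cod _ _ _ _) e'.
(* Source and target become variables, so that the casts can be eliminated. *)
move: (ksum ks m + ksum ls m')%R (ksum (ls ++ ks) (m + m')%R).
move: (sumn (map succn ls) + m)%R e => q e; subst q.
move=> p q ep eq e'; subst p q.
have E_mon := prop_mon E.
by rewrite !hcast_id !(mon_tens1 E_mon).
Qed.

End Shuffle.

Lemma ksum_cat1 k ls m : (k.+1 + ksum ls m)%R = ksum (ls ++ [:: k]) m.
Proof. by elim: ls m => [|l ls IH] m //=. Qed.

Section Swap.
Variables (unital : bool) (D : mon_data nat).
Variable i : forall m n, ainf unital m n -> D m n.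

Lemma fcast_hsingle (A B : fun_data D) (e : A = B)
    (e1 : hochschild i A = hochschild i B) m k (x : A (k.+1 + m)%R) :
  fcast e1 (hsingle i k x) = hsingle i k (fcast e x).
Proof. by subst B; rewrite (Prop_irrelevance e1 erefl). Qed.

(* [ls ++ [:: k]] lists the outermost factor first, so [k] belongs to the
   innermost Hochschild complex. *)
Lemma hpure_hsingle (Psi : fun_data D) n (ls : seq nat) k m
    (e : hochn i n (hochschild i Psi) = hochn i n.+1 Psi)
    (e0 : (k.+1 + ksum ls m)%R = ksum (ls ++ [:: k]) m)
    (x : Psi (k.+1 + ksum ls m)%R) : size ls = n ->
  fcast e (hpure i n ls (hsingle i k x)) =
  hpure i n.+1 (ls ++ [:: k]) (ecast p (Psi p) e0 x).
Proof.
move=> eqn; subst n; elim: ls m e e0 x => [|l ls IH] m e e0 x.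
  by rewrite (Prop_irrelevance e erefl) (Prop_irrelevance e0 erefl).
have e1 : hochn i (size ls) (hochschild i Psi) = hochn i (size ls).+1 Psi.
  by rewrite /hochn iterSr.
by rewrite [LHS](fcast_hsingle e1) (IH _ e1).
Qed.

End Swap.

Section TensorGenerators.
Variables (unital : bool) (E : mult_prop unital).
Let i := @mult _ E.
Let E_mon := prop_mon E.

Lemma mult_degree0 m n (x : ainf unital m n) : hdeg 0 x -> hdeg 0 (mult E x).
Proof. by move=> hx; apply: (cm_degree (mf_chain (mult_functor E) m n)). Qed.

Lemma corep_weak_functor m : weak_functor (corep E m).
Proof.
split=> [n p f x y|n p q x f g]; first exact: (cp_additivel (mon_comp E_mon _ _ _)).
exact: (mon_compA E_mon).
Qed.

(** The tensor product with the fixed element given by [g] and l_{k+1}, as a map in [g'] alone;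
    [koszul k] is the sign of moving l_{k+1}, of degree k, past [g']. *)
Definition tens_left m m' k (g : E m k.+1) p (g' : E m' p) :
    hochschild i (corep E (m + m')%R) p :=
  @hsingle _ _ i (corep E (m + m')%R) p k (tens E g (koszul k g')).

(** The sign of moving l_{k+1} past the morphism acting is the same on both sides: [koszul k] is
    multiplicative and also occurs in the Hochschild action. *)
Lemma tens_left_natural m m' k (g : E m k.+1) :
  @natural E (corep E m') (hochschild i (corep E (m + m')%R)) (tens_left g).
Proof.
split=> [p x y|p q x f].
  rewrite /tens_left (koszul_additive (mon_complex E_mon _ _)).
  by rewrite (cp_additiver (mon_tens E_mon _ _ _ _)) hsingle_additive.
rewrite /tens_left (act_hsingle E_mon mult_degree0 (corep_weak_functor _)).
rewrite /= (interchange_degree0 E_mon) ?(mon_comp1r E_mon) ?(koszul_comp E_mon) //.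
exact: mon_id_degree.
Qed.

Lemma tens_hcast (a b q r K K' : nat) (f : E a K) (g : E b q)
    (eK : K = K') (e' : (K + q)%R = r) (e : (K' + q)%R = r) :
  ecast p (E (a + b)%R p) e (tens E (hcast erefl eK f) g) = hcast erefl e' (tens E f g).
Proof. by subst K' r; rewrite (Prop_irrelevance e erefl). Qed.

(** The first factor has no output besides those at its l_{k+1}, so the shuffle moves an empty block
    and is an identity. *)
Lemma comp_shuffle a b k ls m (g : E a (k.+1 + 0)%R) (g' : E b (ksum ls m))
    (e : (k.+1 + ksum ls m)%R = ksum (ls ++ [:: k]) m) :
  comp E (tens E g (koszul (sumn [:: k]) g')) (shuffle E [:: k] ls 0 m) =
  ecast p (E (a + b)%R p) e (tens E (hcast erefl (addr0 k.+1) g) (koszul k g')).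
Proof.
have e' : ((k.+1 + 0) + ksum ls m = ksum (ls ++ [:: k]) (0 + m))%R.
  by rewrite addr0; exact: e.
have e0 : (0 + sumn (map succn ls) = sumn (map succn ls) + 0)%R by rewrite addrC.
rewrite (@shuffle_idm _ E [:: k] ls 0 m _ e' (sym_unitl E_mon (prop_symP E) e0)).
rewrite (comp_hcast_idm E_mon) /= addn0.
by rewrite (tens_hcast _ _ _ e').
Qed.

(** The counterpart of [tens_left] with the second factor fixed. A unit inserted in the first factor
    stays at the same position after adding [id_p] on the right, so [degenerate] elements go to
    0. *)
Lemma tens_idm_exists m p :
  exists H : hochschild i (corep E m) 0 -> hochschild i (corep E (m + p)%R) p,
    additive_map H /\
    forall k (g : E m (k.+1 + 0)%R) (e : (k.+1 + 0)%R = k.+1),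
      H (@hsingle _ _ i (corep E m) 0 k g) = tens_left (hcast erefl e g) (idm E p).
Proof.
pose F k (g : E m (k.+1 + 0)%R) := tens_left (hcast erefl (addr0 k.+1) g) (idm E p).
have Fadd k : additive_map (@F k).
  move=> x y; rewrite /F /tens_left -hsingle_additive; congr hsingle.
  by rewrite hcast_additive (cp_additivel (mon_tens E_mon _ _ _ _)).
have [|H_add H_eval] := @hlift_well_defined _ _ i (corep E m) 0 _ F Fadd.
  move=> ul n j y jn; rewrite /F.
  set u := i (unit_forest unital n j).
  have -> : hcast erefl (addr0 n.+1) (comp E y (tens E u (idm E 0))) =
      comp E (hcast erefl (addr0 n) y) u.
    rewrite -[in RHS](mon_tens0r E_mon u (addr0 n) (addr0 n.+1)).
    by rewrite (comp_hcast (addr0 n)).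
  rewrite /tens_left (koszul_idm E_mon).
  rewrite -{1}(mon_comp1r E_mon (idm E p)).
  rewrite -(interchange_degree0 E_mon); last first.
    exact/mult_degree0/unit_forest_degree.
  exact: (@hsingle_degenerate _ _ i (corep E (m + p)%R) p n j
    (tens E (hcast erefl (addr0 n) y) (idm E p))).
exists (@hlift _ _ i (corep E m) 0 _ F); split=> // k g e.
by rewrite H_eval /F (Prop_irrelevance e (addr0 k.+1)).
Qed.

(* Evaluating [core_tens] on generators needs more than the definition of
   [hliftn], which in the reduced case only sees chosen representatives: both
   variables are shown to enter through well-defined additive maps. *)
Lemma core_tens_generator k (ls : seq nat) m
    (e : ((k.+1 + 0) + ksum ls m = ksum (ls ++ [:: k]) m)%R) :
  core_tens (E := E) (n := 1) (n' := size ls) (m2 := 0) (m2' := m)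
    (hpure i (Phi := corep E (k.+1 + 0)%R) 1 [:: k] (m := 0) (idm E (k.+1 + 0)%R))
    (hpure i (Phi := corep E (ksum ls m)) (size ls) ls (idm E (ksum ls m))) =
  hpure i (Phi := corep E ((k.+1 + 0) + ksum ls m)%R) (size ls).+1 (ls ++ [:: k])
    (hcast erefl e (idm E _)).
Proof.
set M : nat := (k.+1 + 0)%R; set M' := ksum ls m.
set z := hpure i (Phi := corep E M') (size ls) ls (m := m) (idm E M').
have e_sw : hochn i (size ls) (hochschild i (corep E (M + M')%R)) =
    hochn i (size ls).+1 (corep E (M + M')%R).
  by rewrite /hochn iterSr.
pose T k0 (g : E M (k0.+1 + 0)%R) p (g' : E M' p) :=
  tens_left (hcast erefl (addr0 k0.+1) g) g'.
pose H k0 (g : E M (k0.+1 + 0)%R) (y : core_hom E M' m (size ls)) :=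
  fcast e_sw (hochn_map i i (Phi := corep E M')
    (Phi' := hochschild i (corep E (M + M')%R)) (@T k0 g) (size ls) y).
have T_nat k0 g :
    @natural E (corep E M') (hochschild i (corep E (M + M')%R)) (@T k0 g).
  exact: tens_left_natural.
have W a := corep_weak_functor a.
have WH : weak_functor (hochschild i (corep E (M + M')%R)).
  exact: (hochschild_weak_functor E_mon mult_degree0 (W _)).
have key k0 (g : E M (k0.+1 + 0)%R) :
  hliftn i (Phi := corep E M') (size ls) (fun ls0 (g' : E M' (ksum ls0 m)) =>
      hpure i (Phi := corep E (M + M')%R) (1 + size ls)%N (ls0 ++ [:: k0])
        (comp E (tens E g (koszul (sumn [:: k0]) g')) (shuffle E [:: k0] ls0 0 m)))
    z = H k0 g z.
  have [nat_n pure_n] :=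
    hochn_map_natural E_mon mult_degree0 (W M') WH (T_nat k0 g) (size ls).
  have H_add : additive_map (H k0 g).
    by move=> x y; rewrite /H (natural_additive nat_n) fcast_additive.
  rewrite -(hliftn_hpure z H_add); apply: eq_hliftn => ls0 g'.
  rewrite /H pure_n.
  (* For a list of the wrong length both sides are the default value 0 of [hpure]. *)
  have [sz|sz] := eqVneq (size ls0) (size ls); last first.
    rewrite [LHS]hpure_size ?size_cat ?addn1; last by case=> /eqP; rewrite (negPf sz).
    rewrite hpure_size; last exact/eqP.
    by rewrite (additive_map0 (@fcast_additive _ _ _ e_sw m)).
  by rewrite (hpure_hsingle e_sw (ksum_cat1 k0 ls0 m) _ sz) -comp_shuffle.
have [H2 [H2_add H2_eval]] := tens_idm_exists M M'.
(* As [z] is the generator of an identity, [H k0 g z] involves only the tensor product of [g] with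
   that identity. In the first variable it is therefore given by the additive map [H2]. *)
pose L (y : hochschild i (corep E M) 0) :=
  fcast e_sw (hpure i (size ls) ls (m := m) (H2 y)).
have L_add : additive_map L.
  by move=> x y; rewrite /L H2_add hpure_additive fcast_additive.
have L_eval k0 (g : E M (k0.+1 + 0)%R) :
    L (hsingle i (Phi := corep E M) (m := 0) k0 g) = H k0 g z.
  rewrite /L (H2_eval _ _ (addr0 k0.+1)) /H.
  have [_ pure_n] :=
    hochn_map_natural E_mon mult_degree0 (W M') WH (T_nat k0 g) (size ls).
  by rewrite pure_n.
transitivity (L (hsingle i (Phi := corep E M) (m := 0) k (idm E M))).
  rewrite -(hlift_hsingle _ L_add).
  rewrite /core_tens /=.
  congr (hlift i _ _).
  apply: functional_extensionality_dep => k0.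
  apply: functional_extensionality_dep => g.
  by rewrite key L_eval.
rewrite /L (H2_eval _ _ (addr0 k.+1)) (hpure_hsingle e_sw (ksum_cat1 k ls m)) //.
by rewrite (koszul_idm E_mon) (tens_hcast _ _ _ e) (mon_tens1 E_mon).
Qed.

End TensorGenerators.

(** * Restriction of J to the core categories *)

Section CoreComposition.
Variables (unital : bool) (E : mult_prop unital).

Lemma core_comp_pure m1 m2 n ks m3 (f : E m1 m2) (g : E m2 (ksum ks m3)) :
  core_comp (n := n) f (hpure (@mult _ E) (Phi := corep E m2) n ks g) =
  hpure (@mult _ E) (Phi := corep E m1) n ks (comp E f g).
Proof.
have E_mon := prop_mon E.
have f_nat : @natural E (corep E m2) (corep E m1) (fun k g => comp E f g).
  split=> [k x y|k l x h]; first exact: (cp_additiver (mon_comp E_mon _ _ _)).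
  by rewrite /= (mon_compA E_mon).
have [_ H] := hochn_map_natural E_mon (@mult_degree0 _ E) (corep_weak_functor E m2)
  (corep_weak_functor E m1) f_nat n.
exact: H.
Qed.

End CoreComposition.

Section Restriction.
Variables (unital : bool) (E E' : mult_prop unital).
Variables (X : extension E) (X' : extension E').
Variable J : forall a b : (nat * nat)%type, X a b -> X' a b.
Hypothesis J_mon : is_mon_functor J.

Lemma ret_additive (E0 : mult_prop unital) (Y : extension E0) m1 m2 n :
  additive_map (@ret _ _ Y m1 m2 n).
Proof.
move=> x y; apply: (can_inj (@incK _ _ Y m1 m2 n)).
by rewrite (cm_additive (inc_chain Y m1 m2 n)) !retK.
Qed.

Lemma inc_restriction m n (f : E m n) :
  inc X' (restriction J f : core_hom E' m n 0) = J (inc X (f : core_hom E m n 0)).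
Proof. exact: retK. Qed.

Lemma restriction_graded m n : graded_map (@restriction _ _ _ _ _ J m n).
Proof.
have iX := inc_chain X m n 0; have jX := mf_chain J_mon (m, 0%N) (n, 0%N).
split=> [x y|p x hx].
  by rewrite /restriction (cm_additive iX) (cm_additive jX) ret_additive.
have C' : is_complex (core_hom E' m n 0) := mon_complex (prop_mon E') m n.
have iX' := inc_chain X' m n 0.
apply: (graded_map_hdegK C' (mon_complex (ext_mon X') _ _) (f := @inc _ _ X' m n 0)).
- by split; [exact: cm_additive iX' | exact: cm_degree iX'].
- exact: can_inj (@incK _ _ X' m n 0).
by rewrite inc_restriction; apply/(cm_degree jX)/(cm_degree iX).
Qed.

Lemma restriction_koszul k m n (f : E m n) :
  restriction J (koszul k f) = koszul k (restriction J f).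
Proof.
exact: (graded_map_koszul (mon_complex (prop_mon E) m n)
  (mon_complex (prop_mon E') m n) (@restriction_graded m n)).
Qed.

Lemma inc_inj (E0 : mult_prop unital) (Y : extension E0) m1 m2 n :
  injective (@inc _ _ Y m1 m2 n).
Proof. exact: can_inj (@incK _ _ Y m1 m2 n). Qed.

Lemma restriction_id m : restriction J (idm E m) = idm E' m.
Proof.
apply: (@inc_inj _ X' m m 0).
by rewrite inc_restriction inc_id (mf_id J_mon) -inc_id.
Qed.

(** With no Hochschild factors the shuffle reduces to the symmetry of [m2] with 0, which is an
    identity. *)
Lemma core_tens0 (E0 : mult_prop unital) m1 m2 m1' m2'
    (f : E0 m1 m2) (g : E0 m1' m2') :
  core_tens (E := E0) (n := 0) (n' := 0) f g = tens E0 f g.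
Proof.
have M := prop_mon E0.
rewrite /core_tens /= (koszul0 (mon_complex M _ _)).
have e : (m2 + 0 = 0 + m2 :> nat)%R by rewrite addr0.
rewrite (@shuffle_idm _ E0 [::] [::] m2 m2' e erefl).
  exact: (mon_comp1r M).
exact: (sym_unitr M (prop_symP E0)).
Qed.

Lemma restriction_tens a b a' b' (f : E a b) (g : E a' b') :
  restriction J (tens E f g) = tens E' (restriction J f) (restriction J g).
Proof.
have T := inc_tens X (n := 0) (n' := 0) f g.
have T' := inc_tens X' (n := 0) (n' := 0) (restriction J f) (restriction J g).
have JT := mf_tens J_mon (inc X (f : core_hom E a b 0))
  (inc X (g : core_hom E a' b' 0)).
rewrite -!inc_restriction T' T in JT.
apply: (@inc_inj _ X' (a + a')%R (b + b')%R 0); rewrite inc_restriction.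
by rewrite -!core_tens0; apply: JT.
Qed.

Hypothesis J_gen : preserves_generators J.

Lemma J_pure_idm n ks m : size ks = n ->
  J (inc X (hpure (@mult _ E) (Phi := corep E (ksum ks m)) n ks
       (idm E (ksum ks m)) : core_hom E (ksum ks m) m n)) =
  inc X' (hpure (@mult _ E') (Phi := corep E' (ksum ks m)) n ks
       (idm E' (ksum ks m)) : core_hom E' (ksum ks m) m n).
Proof.
(* Lists name the outermost factor first, so tensoring with a generator on the left appends its
   index at the end. *)
elim/last_ind: ks n m => [|ls k IH] [|n] m //.
- by move=> _; rewrite [LHS](congr1 (@J _ _) (inc_id X m)) (mf_id J_mon) [RHS]inc_id.
- by rewrite size_rcons.
rewrite size_rcons -cats1 => -[eqn]; subst n.
have JT := mf_tens J_mon
  (inc X (hpure (@mult _ E) (Phi := corep E (k.+1 + 0)%R) 1 [:: k]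
                (idm E (k.+1 + 0)%R) : core_hom E (k.+1 + 0)%R 0 1))
  (inc X (hpure (@mult _ E) (Phi := corep E (ksum ls m)) (size ls) ls
     (idm E (ksum ls m)) : core_hom E (ksum ls m) m (size ls))).
rewrite J_gen IH // inc_tens inc_tens in JT.
have e : ((k.+1 + 0) + ksum ls m = ksum (ls ++ [:: k]) m)%R.
  by rewrite addr0; apply: ksum_cat1.
rewrite (core_tens_generator E e) (core_tens_generator E' e) in JT.
(* The source of the tensor product agrees with the desired one only propositionally; as a variable
   [a] it can be substituted. *)
suff gen a (ea : a = ksum (ls ++ [:: k]) m) :
  J (inc X (hpure (@mult _ E) (Phi := corep E a) (size ls).+1 (ls ++ [:: k])
      (hcast erefl ea (idm E a)) : core_hom E a m (size ls).+1)) =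
  inc X' (hpure (@mult _ E') (Phi := corep E' a) (size ls).+1 (ls ++ [:: k])
      (hcast erefl ea (idm E' a)) : core_hom E' a m (size ls).+1) ->
  J (inc X (hpure (@mult _ E) (Phi := corep E (ksum (ls ++ [:: k]) m))
      (size ls).+1 (ls ++ [:: k]) (idm E _)
      : core_hom E (ksum (ls ++ [:: k]) m) m (size ls).+1)) =
  inc X' (hpure (@mult _ E') (Phi := corep E' (ksum (ls ++ [:: k]) m))
      (size ls).+1 (ls ++ [:: k]) (idm E' _)
      : core_hom E' (ksum (ls ++ [:: k]) m) m (size ls).+1).
  exact: (gen _ e JT).
by subst a.
Qed.

Lemma J_additive m1 m2 n :
  additive_map (fun z : core_hom E m1 m2 n => ret X' (J (inc X z))).
Proof.
move=> x y; rewrite (cm_additive (inc_chain X _ _ _)).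
by rewrite (cm_additive (mf_chain J_mon _ _)) ret_additive.
Qed.

Lemma J_pure m1 m2 n ks (g : E m1 (ksum ks m2)) :
  ret X' (J (inc X (hpure (@mult _ E) (Phi := corep E m1) n ks g
    : core_hom E m1 m2 n))) =
  hpure (@mult _ E') (Phi := corep E' m1) n ks (restriction J g).
Proof.
have [sz|sz] := eqVneq (size ks) n; last first.
  by rewrite !hpure_size ?(additive_map0 (@J_additive _ _ _)) //; apply/eqP.
apply: (@inc_inj _ X' m1 m2 n); rewrite retK.
have pure (E0 : mult_prop unital) (g0 : E0 m1 (ksum ks m2)) :
    hpure (@mult _ E0) (Phi := corep E0 m1) n ks g0 =
    core_comp g0 (hpure (@mult _ E0) (Phi := corep E0 _) n ks (idm E0 _)).
  by rewrite core_comp_pure (mon_comp1r (prop_mon E0)).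
rewrite (pure E) (pure E') -!inc_comp (mf_comp J_mon) J_pure_idm //.
by rewrite inc_restriction.
Qed.

End Restriction.

(** * Comparison of the actions *)

(** The sources of the actions are complexes that are not values of a functor, hence this second
    transport. *)
Definition ccast (A B : complex) (e : A = B) (x : A) : B := ecast C (C : complex) e x.

Lemma ccastK (A B : complex) (e : A = B) : cancel (ccast e) (ccast (esym e)).
Proof. by case: _ / e. Qed.

Lemma ccastKV (A B : complex) (e : A = B) : cancel (ccast (esym e)) (ccast e).
Proof. by case: _ / e. Qed.

Lemma fcastE (D : mon_data nat) (A B : fun_data D) (e : A = B) m (e' : A m = B m) x :
  fcast e x = ccast e' x.
Proof. by subst B; rewrite (Prop_irrelevance e' erefl). Qed.

Lemma fcast_chain_map (D : mon_data nat) (A B : fun_data D) (e : A = B) m :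
  chain_map (@fcast _ _ _ e m).
Proof. by case: _ / e. Qed.

Lemma fcast_bijective (D : mon_data nat) (A B : fun_data D) (e : A = B) m :
  bijective (@fcast _ _ _ e m).
Proof. by case: _ / e; exists id. Qed.

Lemma fcast_act (D : mon_data nat) (A B : fun_data D) (e : A = B) m n
    (z : A m) (f : D m n) :
  fcast e (act A z f) = act B (fcast e z) f.
Proof. by case: _ / e. Qed.

Lemma fcast_hlift (D D0 : mon_data nat) (A B : fun_data D) (e : A = B) p
    unital (i : forall m n, ainf unital m n -> D0 m n) (Psi : fun_data D0) m
    (G : forall n, Psi (n.+1 + m)%R -> A p) (z : hochschild i Psi m) :
  fcast e (hlift i G z) = hlift i (fun n x => fcast e (G n x)) z.
Proof. by case: _ / e. Qed.

Lemma fcast_hliftn (D D0 : mon_data nat) (A B : fun_data D) (e : A = B) p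
    unital (i : forall m n, ainf unital m n -> D0 m n) (Psi : fun_data D0) n m
    (G : forall ks, Psi (ksum ks m) -> A p) (z : hochn i n Psi m) :
  fcast e (hliftn i n G z) = hliftn i n (fun ks x => fcast e (G ks x)) z.
Proof. by case: _ / e. Qed.

Lemma tensor_map_id (A B : complex) (t : tensor A B) : tensor_map idfun idfun t = t.
Proof.
rewrite /tensor_map /tlift /descend -[RHS]qclass_repr.
rewrite -(dlift_comp_single _ (@qclass_additive _ (@tensor_relations A B))).
congr (dlift _ _); apply: functional_extensionality_dep => -[a b].
apply: functional_extensionality_dep => c; rewrite /tpure.
rewrite -(additive_map_mulrz (@qclass_additive _ _)); congr qclass.
rewrite -(additive_map_mulrz (@single_additive _ _ _)); congr single.
by rewrite /= intz.
Qed.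

Lemma tensor_pow_map_id (A B : complex) n (t : tensor_pow A n B) :
  tensor_pow_map idfun idfun t = t.
Proof.
elim: n t => [|n IH] t //=; rewrite -[RHS]tensor_map_id; congr (tensor_map _ _ t).
exact: functional_extensionality_dep.
Qed.

Lemma tensor_pow_map_ccast (A A' B : complex) (e : A = A') n
    (e' : tensor_pow A n B = tensor_pow A' n B) t :
  tensor_pow_map (ccast e) idfun t = ccast e' t.
Proof.
subst A'; rewrite (Prop_irrelevance e' erefl); exact: tensor_pow_map_id.
Qed.

(** Evaluation at chosen representatives does no harm: once the equalities are eliminated, [G] and
    [G'] are the same function. *)
Lemma tlift_ccast (A A' B B' W W' : complex) (eA : A = A') (eB : B = B') (eW : W = W')
    (G : A -> B -> W) (G' : A' -> B' -> W') (t : tensor A B) :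
  (forall x y, ccast eW (G x y) = G' (ccast eA x) (ccast eB y)) ->
  ccast eW (tlift G t) = tlift G' (tensor_map (ccast eA) (ccast eB) t).
Proof.
subst A' B' W' => GG'; have -> : G' = G.
  apply: functional_extensionality_dep => x.
  apply: functional_extensionality_dep => y.
  exact: esym (GG' x y).
by rewrite -[X in tlift G X = _]tensor_map_id.
Qed.

(** Kept general in [P] in order to cover strict inverses and homotopy inverses alike. *)
Lemma ccast_inverse (P : forall A B : complex, (A -> B) -> (B -> A) -> Prop)
    (A A' B B' : complex) (eA : A = A') (eB : B = B')
    (f : A -> B) (f' : A' -> B') (g : B -> A) :
  (forall x, ccast eB (f x) = f' (ccast eA x)) ->
  P _ _ f g -> P _ _ f' (fun y => ccast eA (g (ccast (esym eB) y))).
Proof.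
subst A' B' => ff'; have -> // : f' = f.
by apply: functional_extensionality_dep => x; apply: esym (ff' x).
Qed.

Section Main.
Variables (unital : bool) (E E' : mult_prop unital).
Variables (X : extension E) (X' : extension E').
Variable J : forall a b : (nat * nat)%type, X a b -> X' a b.
Hypothesis J_mon : is_mon_functor J.
Hypothesis J_gen : preserves_generators J.
Hypothesis J_mult : forall (m n : nat) (a : ainf unital m n),
  mult E' a = restriction J (mult E a).
Variable Phi : mfun_data E'.
Hypothesis Phi_mon : is_monoidal Phi.

Notation pb := (fun_pullback (@restriction _ _ _ _ _ J)).
Notation Ch n := (hochn (@mult _ E) n (pullback J Phi)).
Notation Ch' n := (hochn (@mult _ E') n Phi).

Let R_id := restriction_id J_mon.
Let R_tens := restriction_tens J_mon.
Let R_koszul := restriction_koszul J_mon.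

(** [identify] rebuilds an element from its generators. Through the equality of functors this
    becomes expansion and reassembly inside one complex, which is the identity. *)
Lemma identify_fcast n (e : Ch n = pb (Ch' n)) m (z : Ch n m) :
  identify z = fcast e z.
Proof.
have [e1 [_ H]] := hochn_fun_pullback R_id R_tens R_koszul J_mult Phi n.
rewrite (Prop_irrelevance e e1) /identify /hochn_map.
rewrite [LHS]H.
exact: (@hliftn_hpure _ _ (@mult _ E') Phi n m _ id).
Qed.

Lemma hochn_pullback n : Ch n = pb (Ch' n).
Proof. by have [] := hochn_fun_pullback R_id R_tens R_koszul J_mult Phi n. Qed.

Lemma identify_hpure n ks m x :
  identify (hpure (@mult _ E) n ks x : Ch n m) = hpure (@mult _ E') n ks x.
Proof.
have [e [H _]] := hochn_fun_pullback R_id R_tens R_koszul J_mult Phi n.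
by rewrite (identify_fcast e) H.
Qed.

Lemma identificationP : identification J Phi.
Proof.
have e := hochn_pullback 1.
have E1 m : @identify _ _ _ _ _ J Phi 1 m = @fcast _ _ _ e m.
  by apply: functional_extensionality_dep => z; apply: identify_fcast.
split=> [m|m m' z f].
  by rewrite E1; split; [exact: (fcast_bijective e m) | exact: (fcast_chain_map e m)].
by rewrite !(identify_fcast e) fcast_act.
Qed.

Lemma identify_hliftn n0 p n m
    (G : forall ks, Phi (ksum ks m) -> Ch n0 p)
    (G' : forall ks, Phi (ksum ks m) -> Ch' n0 p) (z : Ch n m) :
  (forall ks x, identify (G ks x) = G' ks x) ->
  identify (hliftn (@mult _ E) (Phi := pullback J Phi) n G z) =
  hliftn (@mult _ E') (Phi := Phi) n G' (identify z).
Proof.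
move=> GG'; have e0 := hochn_pullback n0.
have [e [_ H]] := hochn_fun_pullback R_id R_tens R_koszul J_mult Phi n.
rewrite (identify_fcast e0) (identify_fcast e) -H fcast_hliftn.
by apply: eq_hliftn => ks x; rewrite -(identify_fcast e0).
Qed.

Lemma identify_hlift n0 p m
    (G : forall k, Phi (k.+1 + m)%R -> Ch n0 p)
    (G' : forall k, Phi (k.+1 + m)%R -> Ch' n0 p) (z : Ch 1 m) :
  (forall k x, identify (G k x) = G' k x) ->
  identify (hlift (@mult _ E) (Phi := pullback J Phi) G z) =
  hlift (@mult _ E') (Phi := Phi) G' (identify z).
Proof.
move=> GG'; have e0 := hochn_pullback n0.
have [e [_ H]] := hochschild_fun_pullback R_id R_tens R_koszul J_mult Phi.
rewrite (identify_fcast e0) (identify_fcast (n := 1) e) -H fcast_hlift.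
congr (hlift _ _ z); apply: functional_extensionality_dep => k.
by apply: functional_extensionality_dep => x; rewrite -(identify_fcast e0).
Qed.

Lemma identify_lambda_mul n m (z : Ch 1 0%N) (y : Ch n m) :
  identify (lambda_mul (Phi := pullback J Phi) z y : Ch n.+1 m) =
  lambda_mul (identify z) (identify y).
Proof.
apply: (identify_hlift (n0 := n.+1)) => k x.
apply: (identify_hliftn (n0 := n.+1)) => ks v.
exact: identify_hpure.
Qed.

Lemma hochn_complex n m : Ch n m = Ch' n m.
Proof. by rewrite hochn_pullback. Qed.

Lemma identify_ccast n m (e : Ch n m = Ch' n m) (z : Ch n m) :
  identify z = ccast e z.
Proof.
rewrite (identify_fcast (hochn_pullback n)).
exact: (@fcastE _ _ (pb (Ch' n)) _ m e z).
Qed.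

Lemma source_complex n m : source (pullback J Phi) n m = source Phi n m.
Proof. by rewrite /source hochn_complex. Qed.

Lemma identify_source_ccast n m (e : source (pullback J Phi) n m = source Phi n m)
    (t : source (pullback J Phi) n m) :
  identify_source t = ccast e t.
Proof.
rewrite -(tensor_pow_map_ccast (hochn_complex 1 0) e) /identify_source.
congr (tensor_pow_map _ _ t).
by apply: functional_extensionality_dep => z; apply: identify_ccast.
Qed.

Lemma identify_lambda n m (t : source (pullback J Phi) n m) :
  identify (lambda t) = lambda (identify_source t).
Proof.
elim: n t => [|n IH] t; first by rewrite /identify_source /=.
rewrite (identify_ccast (hochn_complex n.+1 m)).
rewrite [LHS](tlift_ccast (eA := hochn_complex 1 0) (eB := source_complex n m)
  (G' := fun z t => lambda_mul z (lambda t))) => [|z y].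
  have <- : @identify _ _ _ _ _ J Phi 1 0 = ccast (hochn_complex 1 0).
    by apply: functional_extensionality_dep => z; apply: identify_ccast.
  have <- : @identify_source _ _ _ _ _ J Phi n m = ccast (source_complex n m).
    by apply: functional_extensionality_dep => y; apply: identify_source_ccast.
  reflexivity.
rewrite -!identify_ccast -identify_source_ccast -IH; exact: identify_lambda_mul.
Qed.

Lemma identify_ext_act n1 m1 n2 m2 (z : Ch n1 m1) (f : X (m1, n1) (m2, n2)) :
  identify (ext_act (Phi := pullback J Phi) z f) =
  ext_act (X := X') (identify z) (J f).
Proof.
apply: (identify_hliftn (n0 := n2)) => ks x.
set w := ret X _.
(* Since [J] fixes the element given by [id] and the factors l, the composite formed in [X'] is the
   image under [J] of the composite [w] formed in [X]. *)
have -> : ret X' (comp X' (inc X' (hpure (@mult _ E')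
      (Phi := corep E' (ksum ks m1)) n1 ks (idm E' (ksum ks m1))
      : core_hom E' (ksum ks m1) m1 n1)) (J f)) =
    ret X' (J (inc X w)).
  rewrite retK (mf_comp J_mon); congr (ret X' (comp X' _ _)).
  by rewrite -(restriction_id J_mon) -(J_pure J_mon J_gen n1 (m2 := m1)) retK.
have Phi_functor := mfun_functor Phi_mon.
have Phi_weak : weak_functor Phi.
  split=> [m n g u v|]; last exact: (fun_comp Phi_functor).
  exact: (cp_additivel (fun_pairing Phi_functor m n)).
have act_nat : @natural E' (corep E' (ksum ks m1)) Phi (fun p g => act Phi x g).
  split=> [p u v|p q u g].
    exact: (cp_additiver (fun_pairing Phi_functor _ _)).
  by rewrite (fun_comp Phi_functor).
have [T_nat T_pure] := hochn_map_natural (prop_mon E') (@mult_degree0 _ E')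
  (corep_weak_functor E' (ksum ks m1)) Phi_weak act_nat n2.
rewrite (identify_fcast (hochn_pullback n2)) /hochn_map fcast_hliftn.
(* An additive map taking [w] to the right-hand side, so that [w] may be expanded in generators. On
   each of them [J] restricts the factor in [E], exactly as the action on the pullback does. *)
pose h (z : core_hom E (ksum ks m1) m2 n2) :=
  hochn_map (@mult _ E') (@mult _ E') (Phi := corep E' (ksum ks m1)) (Phi' := Phi)
    (fun p g => act Phi x g) n2 (ret X' (J (inc X z))).
have h_add : additive_map h.
  by move=> u v; rewrite /h (J_additive J_mon) (natural_additive T_nat).
rewrite -[RHS]/(h w) -(hliftn_hpure w h_add); apply: eq_hliftn => ls g.
by rewrite -identify_fcast identify_hpure /h (J_pure J_mon J_gen) T_pure.
Qed.

(** In either direction the inverse of [lambda] is conjugated by the identifications, which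
    intertwine both [lambda] and [ext_act]. *)
Lemma factors_throughP (P : forall A B : complex, (A -> B) -> (B -> A) -> Prop) :
  @factors_through _ _ _ _ _ J Phi
    (fun linv => forall n m, P _ _ (@lambda _ _ (pullback J Phi) n m) (linv n m))
    (fun linv => forall n m, P _ _ (@lambda _ _ Phi n m) (linv n m)).
Proof.
pose eS := source_complex; pose eC := hochn_complex.
split=> [linv Plinv|linv' Plinv'].
- exists (fun n m y => ccast (eS n m) (linv n m (ccast (esym (eC n m)) y))).
  split=> [n m|n1 m1 n2 m2 t f].
    apply: ccast_inverse (Plinv n m) => t.
    by rewrite -identify_ccast -identify_source_ccast identify_lambda.
  rewrite /action /gamma -identify_lambda -identify_ext_act.
  by rewrite (identify_ccast (eC n2 m2)) ccastK -identify_source_ccast.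
- exists (fun n m y => ccast (esym (eS n m)) (linv' n m (ccast (eC n m) y))).
  split=> [n m|n1 m1 n2 m2 t f].
    have H t : ccast (esym (eC n m)) (lambda t) = lambda (ccast (esym (eS n m)) t).
      apply: (can_inj (ccastK (eC n m))); rewrite ccastKV.
      rewrite -identify_ccast identify_lambda.
      by rewrite (identify_source_ccast (eS n m)) ccastKV.
    have := ccast_inverse H (Plinv' n m).
    by rewrite esymK.
  rewrite /action /gamma -identify_lambda -identify_ext_act.
  by rewrite (identify_source_ccast (eS n2 m2)) ccastKV -identify_ccast.
Qed.

End Main.

Theorem theorem5p13 (unital : bool) (E E' : mult_prop unital)
    (X : extension E) (X' : extension E')
    (sX : ext_symmetry X) (sX' : ext_symmetry X')
    (J : forall a b : (nat * nat)%type, X a b -> X' a b)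
    (J_monoidal : is_mon_functor J)
    (J_symmetric : preserves_symmetry (ext_sym sX) (ext_sym sX') J)
    (J_generators : preserves_generators J)
    (J_mult : forall (m n : nat) (a : ainf unital m n),
        mult E' a = restriction J (mult E a))
    (Phi : mfun_data E') (Phi_monoidal : is_monoidal Phi) :
  (is_split Phi ->
     identification J Phi /\
     @factors_through unital E E' X X' J Phi
       (@lambda_inverse unital E (pullback J Phi))
       (@lambda_inverse unital E' Phi)) /\
  (is_hsplit Phi ->
     identification J Phi /\
     @factors_through unital E E' X X' J Phi
       (@lambda_homotopy_inverse unital E (pullback J Phi))
       (@lambda_homotopy_inverse unital E' Phi)).
Proof.
have F := factors_throughP J_monoidal J_generators J_mult Phi_monoidal.
split=> _; (split; first exact: identificationP).
  exact: (F (fun A B f g => cancel f g /\ cancel g f)).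
exact: (F homotopy_inverse).
Qed.
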